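(* Let $X$ be a zero-dimensional compact metrizable space and $f\colon X\to X$ a continuous map. Then $(X,f)$ can be embedded in the real line with vanishing derivative if and only if all finite orbits of $(X,f)$ are attractors.
   Context: A space is zero-dimensional when it has a base of clopen sets. A dynamical system $(X,f)$ is a space $X$ with a continuous map $f\colon X\to X$. $(X,f)$ can be embedded in the real line with vanishing derivative when there exist a differentiable function $g\colon\mathbb{R}\to\mathbb{R}$, a closed set $Z\subset\mathbb{R}$ invariant for $g$ (that is, $g(Z)\subset Z$), and a homeomorphism $\psi\colon X\to Z$ such that $g|_Z=\psi\circ f\circ\psi^{-1}$ and $g'(z)=0$ for all $z\in Z$. A finite orbit is a periodic orbit, i.e. a set $p=\{x,f(x),\dots,f^{k-1}(x)\}$ with $k\ge 1$ and $f^k(x)=x$. A subset $u\subset X$ is stable when $f(u)\subset u$. A finite orbit $p$ is attracting (an attractor) when there exists a stable clopen set $u\subset X$ containing $p$ such that $\bigcap_{n\ge 0}f^n(u)=p$. *)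

(* Defs.v *)
From HB Require Import structures.
From mathcomp Require Import all_boot all_order all_algebra.
From mathcomp Require Import all_classical all_reals all_analysis.

Set Implicit Arguments.
Unset Strict Implicit.
Unset Printing Implicit Defensive.

Import Order.TTheory GRing.Theory Num.Theory.
Import numFieldNormedType.Exports.

Local Open Scope classical_set_scope.
Local Open Scope ring_scope.

(* Not the library's [zero_dimensional], which only asks that distinct points
   be separated by a clopen set. *)
Definition has_clopen_basis (X : topologicalType) : Prop :=
  exists2 B : set (set X), basis B & B `<=` @clopen X.

Definition inverse_homeomorphisms (T U : topologicalType)
    (h : T -> U) (k : U -> T) : Prop :=
  [/\ continuous h, continuous k, cancel h k & cancel k h].

Definition metrizable (R : realType) (X : topologicalType) : Prop :=
  exists (M : metricType R) (h : X -> M) (k : M -> X),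
    inverse_homeomorphisms h k.

(* [psi] has values in the subtype [set_type Z] of [R], which carries the
   topology induced by [R]; [psi'] is the inverse of [psi]. *)
Definition embeds_with_vanishing_derivative (R : realType)
    (X : topologicalType) (f : X -> X) : Prop :=
  exists (g : R -> R) (Z : set R) (psi : X -> set_type Z)
      (psi' : set_type Z -> X),
    [/\ forall x : R, derivable g x 1,
        closed Z /\ g @` Z `<=` Z,
        inverse_homeomorphisms psi psi',
        forall z : set_type Z, g (set_val z) = set_val (psi (f (psi' z))) &
        forall z : R, Z z -> derive1 g z = 0].

Definition finite_orbit (X : Type) (f : X -> X) (p : set X) : Prop :=
  exists (x : X) (k : nat),
    [/\ (1 <= k)%N, iter k f x = x & p = [set iter i f x | i in `I_k]].

Definition stable (X : Type) (f : X -> X) (u : set X) : Prop :=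
  f @` u `<=` u.

Definition attracting (X : topologicalType) (f : X -> X) (p : set X) : Prop :=
  exists u : set X,
    [/\ stable f u, clopen u, p `<=` u & \bigcap_n (iter n f @` u) = p].

(* Main.v *)
(* If the derivative vanishes, then near a finite orbit the map halves the
   distance to the orbit, so a clopen set squeezed between two small
   neighbourhoods of the orbit is stable and shrinks to it.

   Conversely, a sequence of clopen sets [U_0, U_1, ...] separating points gives
   the embedding [psi x = \sum_m w_m U_m(x)], where [w_m = 1 / (4^m m!)]: the
   distance of [psi x] and [psi y] is comparable to [w_n] for the first [n] such
   that [U_n] separates [x] and [y].  As [w_(n+1) / w_n] tends to 0, the map
   induced on the image has derivative 0 at [psi x] as soon as, for all large
   [m], any [y] that agrees with [x] on [U_0, ..., U_(m-1)] satisfies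
   [U_m (f x) = U_m (f y)].

   To adjoin a clopen set [W] one adjoins [W_(k-1), ..., W_1, W_0 = W], where
   [W_(j+1) = f^-1 W_j \ D]; the condition then fails only at points of [D].
   The chain stops when every orbit either meets [D] or enters the basin of the
   periodic points of period at most [n], provided [W] contains none of those:
   this is where finite orbits have to be attractors.  The sets [D] used at the
   successive stages are pairwise disjoint, so the condition fails only finitely
   often at each point.  They are obtained by splitting: if [G] is met within
   time [K] by all orbits outside the basin, and [c] is a locally constant
   colouring with [c x <> c (f^j x)] for [1 <= j <= K], then [G] is split
   according to whether [c] increases from [x] to its first return to [G]; a
   bounded colour can neither increase forever nor decrease forever.

   The map on the image extends to the line by a smooth step on each gap. *)
Require Import Defs.
From HB Require Import structures.
From mathcomp Require Import all_boot all_order all_algebra.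
From mathcomp Require Import all_classical all_reals all_analysis.
From mathcomp Require Import ring lra.

Import Order.TTheory GRing.Theory Num.Theory.
Import numFieldNormedType.Exports.

Local Open Scope classical_set_scope.
Local Open Scope ring_scope.

Set Implicit Arguments.
Unset Strict Implicit.
Unset Printing Implicit Defensive.

(** * Locally constant maps and uniformity by compactness *)

Definition locally_constant (X : topologicalType) (T : Type) (h : X -> T) :=
  forall x, \forall y \near x, h y = h x.

Section locally_constant.
Context {X : topologicalType}.

Lemma locally_constant_comp (T U : Type) (g : T -> U) (h : X -> T) :
  locally_constant h -> locally_constant (fun x => g (h x)).
Proof. by move=> hlc x; apply: filterS (hlc x) => y ->. Qed.

Lemma locally_constant_comp2 (T U W : Type) (g : T -> U -> W)
    (h : X -> T) (k : X -> U) :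
  locally_constant h -> locally_constant k ->
  locally_constant (fun x => g (h x) (k x)).
Proof.
by move=> hlc klc x; apply: filterS2 (hlc x) (klc x) => y -> ->.
Qed.

Lemma locally_constant_iter (T : Type) (h : X -> T) (f : X -> X) j :
  continuous f -> locally_constant h ->
  locally_constant (fun x => h (iter j f x)).
Proof.
move=> fc; elim: j h => [//|j IH] h hlc.
by apply: (IH (fun x => h (f x))) => x; exact: (fc x) _ (hlc (f x)).
Qed.

Lemma locally_constant_mkseq (T : Type) (h : nat -> X -> T) n :
  (forall j, (j < n)%N -> locally_constant (h j)) ->
  locally_constant (fun x => mkseq (h ^~ x) n).
Proof.
elim: n => [|n IH] hlc; first by move=> x; exact: nearW.
under eq_fun do rewrite mkseqS.
apply: locally_constant_comp2; last exact: hlc.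
by apply: IH => j jn; apply: hlc; rewrite ltnS ltnW.
Qed.

Lemma locally_constant_clopen (V : X -> bool) :
  locally_constant V <-> clopen [set x | V x].
Proof.
split=> [Vlc|[oV cV] x].
  split; last (rewrite -openC; rewrite openE => x /= nVx; move: (Vlc x)).
    by rewrite openE => x /= Vx; apply: filterS (Vlc x) => y /= ->.
  by apply: filterS => y /= ->.
have [Vx|nVx] := boolP (V x).
  by apply: filterS (open_nbhs_nbhs (conj oV Vx)).
move: cV; rewrite -openC => oV'.
have nVx' : (~` [set z | V z]) x by apply/negP.
by apply: filterS (open_nbhs_nbhs (conj oV' nVx')) => y /negP/negbTE.
Qed.

(** The near-covering form of compactness, with indices tending to infinity; monotonicity turns one
    good index near [x] into all larger ones. *)
Lemma compact_uniform (Q : nat -> X -> Prop) :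
  compact [set: X] -> (forall n x, Q n x -> Q n.+1 x) ->
  (forall x : X, exists n, \forall y \near x, Q n y) ->
  exists n, forall x, Q n x.
Proof.
move=> /(compact_near_coveringP [set: X]) cX Qmono Qloc.
have [n _ Qn] : \forall n \near \oo, [set: X] `<=` Q n.
  apply: (cX nat \oo Q) => x _; have [n Qn] := Qloc x.
  exists ([set y | Q n y], [set k | (n <= k)%N]); first by split=> //; exists n.
  move=> [y k] [/= Qy]; elim: k => [|k IH]; first by case: n Qy {Qn}.
  by rewrite leq_eqVlt => /predU1P[<-//|]; rewrite ltnS => /IH /Qmono.
by exists n => x; apply: Qn => /=.
Qed.

End locally_constant.

Section clopen_subcover.
Context {X : topologicalType} (V : nat -> X -> bool).
Hypothesis X_compact : compact [set: X].
Hypothesis V_lc : forall j, locally_constant (V j).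

(** The first hypothesis says that [K] is closed, hence compact. Uniting all good [V j] with [j < N]
    makes [u] depend on finitely many locally constant maps. *)
Lemma clopen_subcover (K : X -> Prop) (good : nat -> Prop) :
  (forall x, ~ K x -> \forall y \near x, ~ K y) ->
  (forall x, K x -> exists2 j, good j & V j x) ->
  exists N, let u x := has (fun j => `[< good j >] && V j x) (iota 0 N) in
    locally_constant u /\ forall x, K x -> u x.
Proof.
move=> Kc Kgood.
have [||N QN] := @compact_uniform X (fun N x => K x ->
    exists j, [/\ (j < N)%N, good j & V j x]) X_compact.
- move=> N x Q /Q [j [jN gj Vj]]; exists j; split=> //; exact: ltnW.
- move=> x; have [Kx|nKx] := pselect (K x); last first.
    by exists 0%N; apply: filterS (Kc _ nKx).
  have [j gj Vj] := Kgood x Kx.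
  by exists j.+1; apply: filterS (V_lc j x) => y e _; exists j; rewrite e.
exists N => u; split=> x; last first.
  move=> /QN[j [jN gj Vj]]; apply/hasP; exists j; first by rewrite mem_iota.
  by rewrite Vj andbT; exact/asboolP.
have := locally_constant_mkseq (n := N) (fun j _ => V_lc j) x.
apply: filterS => y e; apply: eq_in_has => j; rewrite mem_iota add0n /= => jN.
by rewrite -(nth_mkseq false (V ^~ y) jN) e nth_mkseq.
Qed.

End clopen_subcover.

(** * Periodic points of bounded period and uniform attraction *)

Definition periodic_upto (X : Type) (f : X -> X) (n : nat) (x : X) :=
  exists2 j, (1 <= j <= n)%N & iter j f x = x.

Lemma periodic_upto_leq (X : Type) (f : X -> X) m n x :
  (m <= n)%N -> periodic_upto f m x -> periodic_upto f n x.
Proof.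
move=> mn [j /andP[j1 jm] fjx]; exists j => //.
by rewrite j1 (leq_trans jm mn).
Qed.

(** Uniform convergence of the orbits of [u] to [P], tested on clopen sets that miss [P]. *)
Definition attracted_to (X : topologicalType) (f : X -> X) (P : X -> Prop)
    (u : X -> bool) :=
  forall V : X -> bool, locally_constant V -> (forall p, P p -> ~~ V p) ->
  exists J, forall j x, (J <= j)%N -> u x -> ~~ V (iter j f x).

Section dynamics.
Context {X : topologicalType} (f : X -> X) (V : nat -> X -> bool).
Hypothesis X_compact : compact [set: X].
Hypothesis X_hausdorff : hausdorff_space X.
Hypothesis f_continuous : continuous f.
Hypothesis V_lc : forall j, locally_constant (V j).
Hypothesis V_surj : forall W : X -> bool, locally_constant W ->
  exists j, V j =1 W.
Hypothesis V_sep : forall x y, x != y -> exists j, V j x != V j y.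

Definition itinerary J x := mkseq (V ^~ x) J.

Lemma itineraryP J x y :
  itinerary J x = itinerary J y <-> (forall j, (j < J)%N -> V j x = V j y).
Proof.
split=> [e j jJ|e]; last by apply/eq_in_map => j; rewrite mem_iota => /e.
by rewrite -(nth_mkseq false (V ^~ x) jJ) -/(itinerary J x) e nth_mkseq.
Qed.

Lemma itinerary_leq J K x y : (J <= K)%N ->
  itinerary K x = itinerary K y -> itinerary J x = itinerary J y.
Proof.
move=> JK /itineraryP e; apply/itineraryP => j jJ.
by apply: e; exact: leq_trans JK.
Qed.

Lemma itinerary_lc J : locally_constant (itinerary J).
Proof. exact: locally_constant_mkseq. Qed.

Lemma itinerary_inj x y : (forall J, itinerary J x = itinerary J y) -> x = y.
Proof.
move=> e; apply: contrapT => /eqP/V_sep[j]; apply/negP; rewrite negbK.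
by apply/eqP; have /itineraryP := e j.+1; apply.
Qed.

Lemma iter_cont j : continuous (iter j f).
Proof.
elim: j => [x|j IH x]; first exact: cvg_id.
by apply: (@continuous_comp _ _ _ (iter j f) f x); [exact: IH|exact: f_continuous].
Qed.

(** The forward images of [u] are compact and decrease to [p]; by compactness one of them already
    misses a given clopen set disjoint from [p]. *)
Lemma attracting_attracted p u : p `<=` u -> stable f u -> clopen u ->
  \bigcap_n (iter n f @` u) = p -> attracted_to f p (fun x => x \in u).
Proof.
move=> pu su cu cap W Wlc Wp.
have closedu n : closed (iter n f @` u).
  apply: compact_closed => //; apply: continuous_compact.
    exact/continuous_subspaceT/iter_cont.
  exact: (subclosed_compact cu.2 X_compact).
have decu n z : (iter n.+1 f @` u) z -> (iter n f @` u) z.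
  by move=> [x ux <-]; exists (f x); [apply: su; exists x | rewrite -iterSr].
have [||J QJ] := @compact_uniform X
  (fun n z => ~ (W z /\ (iter n f @` u) z)) X_compact.
- by move=> n z nQ [Wz /decu uz]; apply: nQ.
- move=> z; have [pz|npz] := pselect (p z).
    exists 0%N; have := Wlc z; apply: filterS => y -> [Wz _].
    by have := Wp _ pz; rewrite Wz.
  have : ~ (\bigcap_n (iter n f @` u)) z by rewrite cap.
  move=> /existsNP[n /not_implyP[_ nz]]; exists n.
  have : open (~` (iter n f @` u)) by rewrite openC.
  by rewrite openE => /(_ _ nz); apply: filterS => y ny [_ /ny].
exists J => j x Jj; rewrite inE => ux; apply/negP => Wx; apply: (QJ (iter j f x)).
split=> //; have : (iter j f @` u) (iter j f x) by exists x.
move: (iter j f x) {Wx} => z; rewrite -(subnKC Jj).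
by elim: (j - J)%N => [|k IH]; rewrite ?addn0// addnS => /decu.
Qed.

Hypothesis orbits_attract : forall p, finite_orbit f p -> attracting f p.

Lemma periodic_upto_iter n x j : periodic_upto f n x ->
  periodic_upto f n (iter j f x).
Proof.
by move=> [k kn fkx]; exists k => //; rewrite -iterD addnC iterD fkx.
Qed.

(** The last clause holds because a periodic point of a stable set lies in all forward images of the
    set, hence in their intersection, here the orbit of [x]. *)
Lemma periodic_attracted n x : periodic_upto f n x ->
  exists u : X -> bool, [/\ locally_constant u, u x,
   attracted_to f (periodic_upto f n) u &
   exists k, forall y, u y -> periodic_upto f n y ->
     exists2 i, (i < k)%N & y = iter i f x].
Proof.
move=> Px; have [k /andP[k1 kn] fkx] := Px.
pose p : set X := [set iter i f x | i in `I_k].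
have [|u [su cu pu cap]] := orbits_attract (p := p); first by exists x, k.
exists (fun y => y \in u); split.
- by apply/locally_constant_clopen; rewrite set_mem_set.
- by rewrite inE; apply: pu; exists 0%N.
- move=> W Wlc WP; apply: (attracting_attracted pu su cu cap) => //.
  by move=> _ [i _ <-]; apply: WP; exact: periodic_upto_iter.
- exists k => y; rewrite inE => uy [j /andP[j1 _] fjy].
  suff: p y by move=> [i ik <-]; exists i.
  (* As [f^j y = y] with [j >= 1], the point [y] is the [m]-th image of its iterate at time
     [m * j - m]. *)
  rewrite -cap => m _; exists (iter (m * j - m) f y).
    elim: (m * j - m)%N => [//|i IH]; rewrite iterS.
    by apply: su; exists (iter i f y).
  rewrite -iterD subnKC ?leq_pmulr//.
  by elim: m => [//|m IH]; rewrite mulSn iterD IH.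
Qed.

Lemma periodic_closed n (x : X) : ~ periodic_upto f n x ->
  \forall y \near x, ~ periodic_upto f n y.
Proof.
move=> nP; elim: n nP => [|n IH] nP.
  by apply: nearW => y [j]; rewrite leqn0; case: j.
have fx : iter n.+1 f x != x.
  by apply/eqP => e; apply: nP; exists n.+1 => //; rewrite ltnSn.
have {}/IH IH : ~ periodic_upto f n x.
  by move=> Px; apply: nP; exact: periodic_upto_leq Px.
have [j Vj] := V_sep fx.
near=> y => -[i /andP[i1]]; rewrite leq_eqVlt ltnS => /orP[/eqP->|iN] fiy.
  move/negP: Vj; apply; apply/eqP.
  have <- : V j y = V j x by near: y; exact: V_lc.
  have <- : V j (iter n.+1 f y) = V j (iter n.+1 f x).
    by near: y; exact: (locally_constant_iter n.+1 f_continuous (V_lc j) x).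
  by rewrite fiy.
apply: (near IH y) => //; exists i => //; exact/andP.
Unshelve. all: end_near. Qed.

(** The points of period at most [n] form a closed set, covered by finitely many attracted clopen
    sets; the union is attracted, with the maximum of the times. *)
Lemma attractor_nbhs n : exists u : X -> bool, [/\ locally_constant u,
  forall x, periodic_upto f n x -> u x & attracted_to f (periodic_upto f n) u].
Proof.
pose good j := attracted_to f (periodic_upto f n) (V j).
have [|x Px|N [ulc uP]] :=
  clopen_subcover X_compact V_lc (K := periodic_upto f n) (good := good).
- exact: periodic_closed.
- have [u [ulc ux uatt _]] := periodic_attracted Px.
  have [j Vj] := V_surj ulc.
  by exists j; [rewrite /good (funext Vj) | rewrite Vj].
exists (fun x => has (fun j => `[< good j >] && V j x) (iota 0 N)); split=> //.
move=> W Wlc WP {ulc uP}; elim: N => [|N [J HJ]]; first by exists 0%N.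
have [gN|ngN] := pselect (good N).
  have [J' HJ'] := gN W Wlc WP; exists (maxn J J') => j x.
  rewrite geq_max => /andP[Jj J'j]; rewrite -addn1 iotaD has_cat.
  by rewrite /= orbF => /orP[/(HJ _ _ Jj)//|/andP[_ /HJ']]; exact.
exists J => j x Jj; rewrite -addn1 iotaD has_cat /= orbF.
by rewrite asboolF//= orbF; exact: HJ.
Qed.

(** Since finite orbits are attractors, each point of period at most [n] is isolated among such
    points; compactness makes the length [J] uniform. *)
Lemma periodic_separated n : exists J, forall x y, periodic_upto f n x ->
  periodic_upto f n y -> itinerary J x = itinerary J y -> x = y.
Proof.
apply: (@compact_uniform X (fun J x => forall y, periodic_upto f n x ->
  periodic_upto f n y -> itinerary J x = itinerary J y -> x = y) X_compact).
  move=> J x Q y Px Py e; apply: Q => //; exact: itinerary_leq e.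
move=> x; have [Px|nPx] := pselect (periodic_upto f n x); last first.
  by exists 0%N; apply: filterS (periodic_closed nPx).
have [u [ulc ux _ [k uk]]] := periodic_attracted Px.
have [W [Wlc Wx WP]] : exists W : X -> bool, [/\ locally_constant W, W x &
    forall y, W y -> periodic_upto f n y -> y = x].
  (* Inside [u] the only candidates are the first [k] iterates of [x]; those different from [x] are
     cut off one at a time. *)
  suff [W [Wlc Wx Wi]] : exists W : X -> bool, [/\ locally_constant W, W x &
      forall i, (i < k)%N -> W (iter i f x) -> iter i f x = x].
    exists (fun y => u y && W y); split.
    - exact: locally_constant_comp2.
    - by rewrite ux.
    - by move=> y /andP[/uk uy Wy] /uy[i ik e]; rewrite e; apply: Wi; rewrite -?e.
  elim: k {uk} => [|k [W [Wlc Wx Wi]]].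
    by exists xpredT; split=> // y; exact: nearW.
  have [e|/V_sep[j Vj]] := eqVneq (iter k f x) x.
    by exists W; split=> // i; rewrite ltnS leq_eqVlt => /predU1P[->//|]; exact: Wi.
  exists (fun y => W y && (V j y == V j x)); split.
  - apply: locally_constant_comp2 => //.
    exact: (locally_constant_comp (eq_op^~ _)).
  - by rewrite Wx eqxx.
  - move=> i; rewrite ltnS leq_eqVlt => /predU1P[->|ik /andP[+ _]]; last exact: Wi.
    by rewrite (negbTE Vj) andbF.
have [j Vj] := V_surj Wlc.
exists j.+1; apply: filterS (Wlc x) => z Wz y Pz Py /itineraryP/(_ j (ltnSn _)).
by rewrite !Vj Wz Wx => /esym Wy; rewrite (WP y)// (WP z)// Wz.
Qed.

Let basin n : X -> bool := projT1 (cid (attractor_nbhs n)).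

Lemma basin_lc n : locally_constant (basin n).
Proof. by rewrite /basin; case: cid => /= u []. Qed.

Lemma basin_periodic n x : periodic_upto f n x -> basin n x.
Proof. by rewrite /basin; case: cid => /= u [_ + _]; exact. Qed.

Lemma basin_attracted n : attracted_to f (periodic_upto f n) (basin n).
Proof. by rewrite /basin; case: cid => /= u []. Qed.

(** * Sets met by all orbits outside a basin, and their splitting *)

Definition meets_orbits n (B : X -> bool) :=
  forall x, exists j, basin n (iter j f x) || B (iter j f x).

Lemma meets_orbits_bounded n B : locally_constant B -> meets_orbits n B ->
  exists K, forall x, exists2 j, (j < K)%N &
    basin n (iter j f x) || B (iter j f x).
Proof.
move=> Blc meet; apply: (@compact_uniform X (fun K x => exists2 j, (j < K)%N &
    basin n (iter j f x) || B (iter j f x)) X_compact).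
  by move=> K x [j jK h]; exists j => //; exact: ltnW.
move=> x; have [j h] := meet x; exists j.+1.
have := locally_constant_iter j f_continuous
  (locally_constant_comp2 orb (basin_lc n) Blc) x.
by apply: filterS => y e; exists j => //; rewrite e.
Qed.

(** The basins need not be nested, but the complement of [basin m] contains no point of period at
    most [n], so orbits from [basin n] eventually stay out of it. *)
Lemma basin_eventually m n x : (n <= m)%N -> (exists j, basin n (iter j f x)) ->
  exists j, basin m (iter j f x).
Proof.
move=> nm [i ui].
have [||J HJ] := @basin_attracted n (fun y => ~~ basin m y).
- exact: locally_constant_comp (basin_lc m).
- by move=> p Pp; rewrite negbK; apply: basin_periodic; exact: periodic_upto_leq Pp.
- by exists (J + i)%N; rewrite iterD -[basin m _]negbK; exact: HJ.
Qed.

(** A point outside [basin K] has no period up to [K], so it differs from its next [K] iterates. By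
    compactness, itineraries of one length [J] detect this; the colour is the numerical code of the
    itinerary. *)
Lemma return_coloring K : exists c : X -> nat, [/\ locally_constant c,
  exists M, forall x, (c x <= M)%N &
  forall x j, (forall i, ~~ basin K (iter i f x)) -> (1 <= j <= K)%N ->
    c (iter j f x) != c x].
Proof.
pose Q k J x := forall j, (1 <= j <= k)%N ->
  itinerary J (iter j f x) != itinerary J x.
have Qmono k J J' x : (J <= J')%N -> Q k J x -> Q k J' x.
  move=> JJ' q j /q; apply: contra => /eqP e; apply/eqP.
  exact: itinerary_leq e.
have [||J QJ] := @compact_uniform X
  (fun J x => (forall i, ~~ basin K (iter i f x)) -> Q K J x) X_compact.
- by move=> J x q /q; exact: Qmono.
- move=> x; have [nb|] := pselect (forall i, ~~ basin K (iter i f x)); last first.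
    move=> /existsNP[i /negP]; rewrite negbK => ui; exists 0%N.
    apply: filterS (locally_constant_iter i f_continuous (basin_lc K) x) => y.
    by rewrite ui => + /(_ i) /negP; exact.
  suff [J QJ] : exists J, \forall y \near x, Q K J y.
    by exists J; apply: filterS QJ.
  have nP : ~ periodic_upto f K x by move=> /basin_periodic; apply/negP/(nb 0%N).
  have : (K <= K)%N by []. 
  elim: {-2}K => [_|k IH kK]; first by exists 0%N; apply: nearW => y [].
  have [J QJ] := IH (ltnW kK).
  have /V_sep[j Vj] : iter k.+1 f x != x.
    by apply/eqP => e; apply: nP; exists k.+1.
  exists (maxn J j.+1); near=> y => i /andP[i1].
  rewrite leq_eqVlt ltnS => /predU1P[->|ik].
    apply/eqP => /itineraryP/(_ j); rewrite leq_max ltnSn orbT => /(_ isT).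
    have -> : V j y = V j x by near: y; exact: V_lc.
    have -> : V j (iter k.+1 f y) = V j (iter k.+1 f x).
      by near: y; exact: (locally_constant_iter k.+1 f_continuous (V_lc j) x).
    by move/eqP: Vj.
  apply: (@Qmono k J) => //; first exact: leq_maxl.
  - by near: y.
  - by rewrite i1.
pose c x := pickle (itinerary J x).
have clc : locally_constant c := locally_constant_comp pickle (itinerary_lc J).
exists c; split=> //.
- apply: (@compact_uniform X (fun M x => (c x <= M)%N) X_compact).
    by move=> M x; exact: leqW.
  by move=> x; exists (c x); apply: filterS (clc x) => y ->.
- move=> x j nb jK; apply: contra (QJ x nb j jK) => /eqP/(pcan_inj pickleK) e.
  exact/eqP.
Unshelve. all: end_near. Qed.

Lemma meets_orbits_split n (G : X -> bool) :
  locally_constant G -> meets_orbits n G ->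
  exists m (D : X -> bool), [/\ (n < m)%N, locally_constant D,
    (forall x, D x -> G x && ~~ basin m x), meets_orbits m D &
    meets_orbits m (fun x => G x && ~~ D x)].
Proof.
move=> Glc Gmeet; have [K HK] := meets_orbits_bounded Glc Gmeet.
(* As [K <= m], the colouring for [m] distinguishes a point from its first return to [G]. *)
pose m := maxn n.+1 K.
have nm : (n < m)%N by rewrite leq_maxl.
have [c [clc [M cM] cneq]] := return_coloring m.
(* [ret] counts from 0, so the return takes place at time [ret x + 1]; if there is none up to time
   [K], the value is [K]. *)
pose ret x := find id (mkseq (fun j => G (iter j.+1 f x)) K).
pose next x := iter (ret x).+1 f x.
have retlc : locally_constant ret.
  apply: (locally_constant_comp (find id)); apply: locally_constant_mkseq => j _.
  exact: (locally_constant_iter j.+1).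
pose D x := [&& G x, c x < c (next x) & ~~ basin m x]%N.
have Dlc : locally_constant D.
  move=> x; near=> y.
  have ry : ret y = ret x by near: y; exact: retlc.
  rewrite /D /next ry.
  congr [&& _, (_ < _)%N & ~~ _]; near: y.
  - exact: Glc.
  - exact: clc.
  - exact: (locally_constant_iter (ret x).+1 f_continuous clc x).
  - exact: basin_lc.
pose outside x := forall j, ~~ basin m (iter j f x).
have outside_iter j x : outside x -> outside (iter j f x).
  by move=> ox i; rewrite -iterD; exact: ox.
have hitG x : outside x -> exists2 j, (j < K)%N & G (iter j f x).
  move=> ox; have [j jK /orP[bj|Gj]] := HK x; last by exists j.
  have [|i bi] := @basin_eventually m n x (ltnW nm); first by exists j.
  by have := ox i; rewrite bi.
have nextP x : outside x -> G (next x) /\ c (next x) != c x.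
  move=> ox; have hasG : has id (mkseq (fun j => G (iter j.+1 f x)) K).
    have [j jK Gj] := hitG _ (outside_iter 1%N x ox).
    apply/hasP; exists (G (iter j.+1 f x)); last by rewrite iterSr.
    by apply/mapP; exists j; rewrite ?mem_iota.
  have retK : (ret x < K)%N.
    by rewrite /ret -{2}(size_mkseq (fun j => G (iter j.+1 f x)) K) -has_find.
  split; first by have := nth_find false hasG; rewrite nth_mkseq.
  by apply: cneq => //; rewrite /= (leq_trans retK)// leq_maxr.
have meetsP (B : X -> bool) :
    (forall x, outside x -> G x -> exists j, B (iter j f x)) ->
    meets_orbits m B.
  move=> hB x; have [ox|] := pselect (outside x); last first.
    by move=> /existsNP[j /negP]; rewrite negbK => bj; exists j; rewrite bj.
  have [j _ Gj] := hitG x ox.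
  have [i Bi] := hB _ (outside_iter j x ox) Gj.
  by exists (i + j)%N; rewrite iterD Bi orbT.
exists m, D; split=> //.
- by move=> x /and3P[-> _ ->].
(* As long as the returns avoid [D], the colour strictly decreases, because consecutive colours
   differ. *)
- apply: meetsP => x; have [k] := ubnP (c x); elim: k x => // k IH x.
  rewrite ltnS => ck ox Gx.
  have [Gn cn] := nextP x ox.
  have [lt|ge] := boolP (c x < c (next x))%N.
    by exists 0%N; rewrite /= /D Gx lt; exact: (ox 0%N).
  have [|j Dj] := IH (next x) _ (outside_iter _ x ox) Gn.
    by apply: leq_trans ck; rewrite ltn_neqAle cn leqNgt.
  by exists (j + (ret x).+1)%N; rewrite iterD.
(* As long as the returns stay in [D], the colour strictly increases, while bounded by [M]. *)
- apply: meetsP => x; have [k] := ubnP (M - c x); elim: k x => // k IH x.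
  rewrite ltnS => ck ox Gx.
  have [Gn cn] := nextP x ox.
  have [lt|ge] := boolP (c x < c (next x))%N; last first.
    by exists 0%N; rewrite /= /D Gx (negbTE ge).
  have [|j Dj] := IH (next x) _ (outside_iter _ x ox) Gn.
    by apply: leq_trans ck; apply: ltn_sub2l => //; exact: leq_trans lt (cM _).
  by exists (j + (ret x).+1)%N; rewrite iterD.
Unshelve. all: end_near. Qed.

(** Splits the remainder again and again: a state [(n, D, G)] holds the set just split off and what
    is left. From stage 1 on the sets [D i] are thus pairwise disjoint; at stage 0 both sets are the
    whole space. *)
Lemma meeting_sequence : exists (n : nat -> nat) (D : nat -> X -> bool),
  [/\ n 0%N = 0%N /\ (forall x, D 0%N x), forall i, (n i < n i.+1)%N,
    forall i, locally_constant (D i) /\ meets_orbits (n i) (D i),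
    forall i x, D i.+1 x -> ~~ basin (n i.+1) x &
    forall x, exists N, forall i, (N <= i)%N -> ~~ D i x].
Proof.
pose ok (s : nat * (X -> bool) * (X -> bool)) :=
  locally_constant s.2 /\ meets_orbits s.1.1 s.2.
pose R (s t : {s | ok s}) := [/\ ((sval s).1.1 < (sval t).1.1)%N,
  locally_constant (sval t).1.2 /\ meets_orbits (sval t).1.1 (sval t).1.2,
  (forall x, (sval t).1.2 x -> (sval s).2 x && ~~ basin (sval t).1.1 x) &
  (sval t).2 =1 (fun x => (sval s).2 x && ~~ (sval t).1.2 x)].
have step s : {t | R s t}.
  apply: cid; case: s => [[[n D] G] [Glc Gmeet]].
  have [m [D' [nm D'lc D'G D'meet G'meet]]] := meets_orbits_split Glc Gmeet.
  have G'lc := locally_constant_comp2 (fun b c => b && ~~ c) Glc D'lc.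
  by exists (exist ok (m, D', fun x => G x && ~~ D' x) (conj G'lc G'meet)).
have Tlc : locally_constant (fun _ : X => true) by move=> x; exact: nearW.
have Tmeet : meets_orbits 0 (fun _ => true) by move=> x; exists 0%N; rewrite orbT.
have [s [s0 sS]] := dependent_choice step
  (exist ok (0%N, fun=> true, fun=> true) (conj Tlc Tmeet)).
pose n i := (sval (s i)).1.1; pose D i := (sval (s i)).1.2.
pose G i := (sval (s i)).2.
have GD i x : D i.+1 x -> G i x by have [_ _ + _] := sS i => /[apply] /andP[].
have GS i x : G i.+1 x = G i x && ~~ D i.+1 x by have [_ _ _ e] := sS i; exact: e.
exists n, D; split.
- by split=> [|x]; rewrite /n /D s0.
- by move=> i; have [] := sS i.
- by case=> [|i]; [rewrite /D /n s0 | have [] := sS i].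
- by move=> i x; have [_ _ + _] := sS i => /[apply] /andP[].
- move=> x; have [[i Di]|nD] := pselect (exists i, D i.+1 x); last first.
    by exists 1%N => -[//|i _]; apply/negP => Di; apply: nD; exists i.
  (* A point of [D i.+1] is missing from the remainder of stage [i.+1], hence from every later
     [D]. *)
  exists i.+2 => -[//|j]; rewrite ltnS => ij; apply/negP => /GD.
  apply/negP; rewrite -(subnKC ij).
  elim: (j - i.+1)%N => [|k IH]; first by rewrite addn0 GS Di andbF.
  by rewrite addnS GS (negbTE IH).
Qed.

(** * Sequences of clopen sets extended with controlled exceptions *)

Definition agree (s : seq (X -> bool)) (x y : X) :=
  [seq w x | w <- s] = [seq w y | w <- s].

(** Equivalently, [w] lies in the Boolean algebra generated by [s]. *)
Definition determined (s : seq (X -> bool)) (w : X -> bool) :=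
  forall x y, agree s x y -> w x = w y.

Lemma agree_rcons s w x y :
  agree (rcons s w) x y <-> agree s x y /\ w x = w y.
Proof.
rewrite /agree !map_rcons; split=> [/rcons_inj[-> ->]//|[-> ->]//].
Qed.

(* [f] maps points that agree on all sets preceding a new one to points that
   agree on the new one, except at points of [D]. *)
Inductive tame_extension (D : X -> bool) (s : seq (X -> bool)) :
    seq (X -> bool) -> Prop :=
| tame_extension_refl : tame_extension D s s
| tame_extension_rcons t w : tame_extension D s t -> locally_constant w ->
    (forall x y, ~~ D x -> agree t x y -> w (f x) = w (f y)) ->
    tame_extension D s (rcons t w).

Lemma tame_extension_trans D s t r : tame_extension D s t ->
  tame_extension D t r -> tame_extension D s r.
Proof.
move=> st; elim=> [//|r' w _ IH wlc wP]; exact: tame_extension_rcons.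
Qed.

Lemma tame_extension_cat D s t : tame_extension D s t -> exists r, t = s ++ r.
Proof.
elim=> [|t' w _ [r ->] _ _]; first by exists [::]; rewrite cats0.
by exists (rcons r w); rewrite rcons_cat.
Qed.

Lemma tame_extension_determined D s t w : tame_extension D s t ->
  determined s w -> determined t w.
Proof.
move=> /tame_extension_cat[r ->] sw x y; rewrite /agree !map_cat => /eqP.
by rewrite eqseq_cat ?size_map// => /andP[/eqP e _]; exact: sw.
Qed.

Lemma tame_extension_lc D s t : tame_extension D s t ->
  (forall m, locally_constant (nth (fun=> false) s m)) ->
  forall m, locally_constant (nth (fun=> false) t m).
Proof.
elim=> [//|t' w _ IH wlc _ slc] m; rewrite nth_rcons.
case: ifP => _; first exact: IH.
by case: ifP => // _ x; exact: nearW.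
Qed.

Lemma tame_extension_nth D s t : tame_extension D s t ->
  forall m, (size s <= m < size t)%N -> forall x y, ~~ D x ->
  (forall l, (l < m)%N -> nth (fun=> false) t l x = nth (fun=> false) t l y) ->
  nth (fun=> false) t m (f x) = nth (fun=> false) t m (f y).
Proof.
elim=> [m|t' w _ IH wlc wP m].
  by case/andP => /leq_ltn_trans /[apply]; rewrite ltnn.
rewrite size_rcons ltnS => /andP[sm mt] x y nDx e.
have {}e l : (l < m)%N -> nth (fun=> false) t' l x = nth (fun=> false) t' l y.
  by move=> lm; have := e l lm; rewrite nth_rcons (leq_trans lm mt).
move: mt; rewrite leq_eqVlt nth_rcons => /predU1P[mt|mt]; last first.
  by rewrite mt; apply: IH => //; rewrite sm.
rewrite mt ltnn eqxx; apply: wP => //.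
apply: (@eq_from_nth _ false); rewrite !size_map// => l lt.
by rewrite !(nth_map (fun=> false))//; apply: e; rewrite mt.
Qed.

(* Adjoins [W_(k-1), ..., W_0 = w] in this order, where
   [W_(j+1) = f^-1 W_j \ D]; the chain breaks off because [W_k] is empty. *)
Lemma tame_extension_set n (D : X -> bool) s w :
  locally_constant D -> meets_orbits n D -> determined s D ->
  locally_constant w -> (forall p, periodic_upto f n p -> ~~ w p) ->
  exists2 t, tame_extension D s t & determined t w.
Proof.
move=> Dlc Dmeet sD wlc wP.
pose W := fix W k x := if k is k'.+1 then W k' (f x) && ~~ D x else w x.
have Wlc k : locally_constant (W k).
  elim: k => [//|k IH] /=.
  apply: (@locally_constant_comp2 X _ _ _ (fun b c => b && ~~ c)
    (fun x => W k (f x)) D) => //.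
  exact: (locally_constant_iter 1 f_continuous IH).
have WE k x : W k x -> w (iter k f x) /\ forall j, (j < k)%N -> ~~ D (iter j f x).
  elim: k x => [//|k IH] x /= /andP[/IH[wk Dk] Dx].
  split; first by rewrite -iterS iterSr.
  by case=> [//|j jk]; rewrite iterSr; exact: Dk.
have [K HK] := meets_orbits_bounded Dlc Dmeet.
have [J HJ] := basin_attracted wlc wP.
(* A point of [W (J + K)] would avoid [D] for [J + K] steps, so it would enter the basin before time
   [K]; more than [J] steps later, at time [J + K], its orbit cannot be in [w]. *)
have WKJ x : W (J + K)%N x = false.
  apply/negP => /WE[wx Dx]; have [j jK] := HK x.
  rewrite (negbTE (Dx j _)) ?(leq_trans jK) ?leq_addl// orbF => /(HJ (J + K - j)%N).
  rewrite -iterD subnK ?wx; last by rewrite (leq_trans (ltnW jK))// leq_addl.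
  by move=> /(_ _)/negP; apply=> //; rewrite -addnBA ?leq_addr// ltnW.
suff H k : forall s, determined s D -> determined s (W k) ->
    exists2 t, tame_extension D s t & determined t w.
  by apply: (H (J + K)%N) => // x y _; rewrite !WKJ.
elim: k {s sD} => [|k IH] s sD sW.
  by exists s => //; exact: tame_extension_refl.
(* Off [D], membership of [x] in [W k.+1] is that of [f x] in [W k]; so a list determining [D] and
   [W k.+1] may receive [W k]. *)
have st : tame_extension D s (rcons s (W k)).
  apply: tame_extension_rcons => //; first exact: tame_extension_refl.
  move=> x y nDx sxy; have := sW x y sxy; rewrite /= nDx -(sD _ _ sxy) nDx.
  by rewrite !andbT.
have [||t tt wt] := IH (rcons s (W k)).
- exact: tame_extension_determined st sD.
- by move=> x y /agree_rcons[].
- by exists t => //; exact: tame_extension_trans st tt.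
Qed.

Lemma tame_extension_family n (D : X -> bool) s (F : nat -> X -> bool) N :
  locally_constant D -> meets_orbits n D -> determined s D ->
  (forall k, locally_constant (F k)) ->
  (forall k p, periodic_upto f n p -> ~~ F k p) ->
  exists2 t, tame_extension D s t &
    (size s < size t)%N /\ forall k, (k < N)%N -> determined t (F k).
Proof.
move=> Dlc Dmeet sD Flc FP; elim: N => [|N [t st [sizet tF]]].
  (* Padding with the empty set keeps the sequence infinite when [X] is finite. *)
  exists (rcons s (fun=> false)); last by rewrite size_rcons ltnSn.
  apply: tame_extension_rcons => //; first exact: tame_extension_refl.
  by move=> x; exact: nearW.
have [r tr rF] := tame_extension_set Dlc Dmeet
  (tame_extension_determined st sD) (Flc N) (FP N).
exists r; first exact: tame_extension_trans st tr.
split.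
  have [q ->] := tame_extension_cat tr.
  by rewrite size_cat (leq_trans sizet)// leq_addr.
move=> k; rewrite ltnS leq_eqVlt => /predU1P[->//|kN].
exact: tame_extension_determined tr (tF k kN).
Qed.

(** Stage [i] extends the current list with exceptions in [D i] only. Each point lies in finitely
    many [D i], so it is an exception at finitely many stages, each adjoining finitely many sets. *)
Lemma eventually_tame_sequence : exists U : nat -> X -> bool,
  [/\ forall m, locally_constant (U m),
    forall x y, x != y -> exists m, U m x != U m y &
    forall x, exists M, forall m y, (M <= m)%N ->
      (forall l, (l < m)%N -> U l x = U l y) -> U m (f x) = U m (f y)].
Proof.
have [n [D [[n0 D0] nS Dprop DB Dfin]]] := meeting_sequence.
have [J0 J0P] := choice (fun i => periodic_separated (n i.+1)).
(* Nondecreasing in [i], at least [i], and at least [J0 i], so that it separates the points of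
   period at most [n i.+1]. *)
pose J i := (i + \sum_(k < i.+1) J0 k)%N.
have J_ge i : (i <= J i)%N by rewrite leq_addr.
have JS i : (J i <= J i.+1)%N by rewrite leq_add// [leqRHS]big_ord_recr leq_addr.
have JP i x y : periodic_upto f (n i.+1) x -> periodic_upto f (n i.+1) y ->
    itinerary (J i) x = itinerary (J i) y -> x = y.
  move=> Px Py e; apply: (J0P i) => //.
  by apply: (itinerary_leq _ e); rewrite /J big_ord_recr /= addnA leq_addl.
have PS i x : periodic_upto f (n i) x -> periodic_upto f (n i.+1) x.
  exact: periodic_upto_leq (ltnW (nS i)).
(* The sets adjoined at stage [i] must avoid the periodic points of period at
   most [n i], hence [V_j \ T_i] instead of [V_j].  A point [x] lying in [T_i]
   for all large [i] shares its [J_i]-itinerary with periodic points [p_i];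
   since [J_i] separates those of period at most [n (i + 1)], [p_i] is constant
   and [x = p_i]. *)
pose T i x := `[< exists2 p, periodic_upto f (n i) p &
  itinerary (J i) p = itinerary (J i) x >].
have Tlc i : locally_constant (T i).
  exact: (locally_constant_comp (fun v => `[< exists2 p, periodic_upto f (n i) p &
    itinerary (J i) p = v >]) (itinerary_lc (J i))).
(* [D i.+1] is included because the next stage needs it determined. Two sets precede the
   [V j \ T i], so [(J i).+2] sets reach all [j < J i]. *)
pose F i k : X -> bool := if k is k'.+1 then
  if k' is k''.+1 then fun x => V k'' x && ~~ T i x else fun x => ~~ T i x
  else D i.+1.
have Flc i k : locally_constant (F i k).
  case: k => [|[|k]] /=; first by have [] := Dprop i.+1.
    exact: locally_constant_comp.
  exact: (@locally_constant_comp2 X _ _ _ (fun b c => b && ~~ c) (V k) (T i)).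
have FP i k p : periodic_upto f (n i) p -> ~~ F i k p.
  move=> Pp; have Tp : T i p by apply/asboolP; exists p.
  case: k => [|[|k]] /=; rewrite ?Tp ?andbF//; apply/negP => /DB/negP; apply.
  by apply: basin_periodic; exact: PS.
pose ok (it : nat * seq (X -> bool)) := determined it.2 (D it.1).
pose R (a b : {it | ok it}) := [/\ (sval b).1 = (sval a).1.+1,
  tame_extension (D (sval a).1) (sval a).2 (sval b).2,
  (size (sval a).2 < size (sval b).2)%N &
  forall k, (k < (J (sval a).1).+2)%N -> determined (sval b).2 (F (sval a).1 k)].
have step a : {b | R a b}.
  apply: cid; case: a => [[i s] sD]; have [Dlc Dmeet] := Dprop i.
  have [t st [sizet tF]] :=
    tame_extension_family (J i).+2 Dlc Dmeet sD (Flc i) (FP i).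
  by exists (exist ok (i.+1, t) (tF 0%N (ltn0Sn _))).
have ok0 : ok (0%N, [::]) by move=> x y _; rewrite /= !D0.
have [a [a0 aS]] := dependent_choice step (exist ok (0%N, [::]) ok0).
pose t i := (sval (a i)).2.
have a1 i : (sval (a i)).1 = i.
  by elim: i => [|i IH]; [rewrite a0 | have [-> _ _ _] := aS i; rewrite IH].
have tS i : tame_extension (D i) (t i) (t i.+1).
  by have [_ + _ _] := aS i; rewrite a1.
have sizet i : (size (t i) < size (t i.+1))%N by have [] := aS i.
have tF i k : (k < (J i).+2)%N -> determined (t i.+1) (F i k).
  by have [_ _ _] := aS i; rewrite a1; exact.
have size_ge i : (i <= size (t i))%N.
  by elim: i => [//|i IH]; exact: leq_ltn_trans (sizet i).
have tprefix i j : (i <= j)%N -> exists r, t j = t i ++ r.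
  move=> /subnKC <-; elim: (j - i)%N => [|k [r tr]].
    by exists [::]; rewrite addn0 cats0.
  have [q tq] := tame_extension_cat (tS (i + k)%N).
  by exists (r ++ q); rewrite addnS tq tr catA.
pose w0 : X -> bool := fun=> false.
(* The lists extend one another and [t m.+1] has more than [m] entries, so the default is never
   reached. *)
pose U m := nth w0 (t m.+1) m.
have UE k m : (m < size (t k))%N -> nth w0 (t k) m = U m.
  move=> mk; have [km|mk'] := leqP k m.+1.
    by have [r tr] := tprefix _ _ km; rewrite /U tr nth_cat mk.
  by have [r ->] := tprefix _ _ (ltnW mk'); rewrite nth_cat size_ge.
have Udet k w x y : determined (t k) w -> (forall l, U l x = U l y) -> w x = w y.
  move=> tw e; apply: tw; apply: (@eq_from_nth _ false); rewrite !size_map// => l lt.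
  by rewrite !(nth_map w0)// UE.
have tlc k m : locally_constant (nth w0 (t k) m).
  elim: k m => [|k IH]; last exact: tame_extension_lc (tS k) IH.
  by move=> m; rewrite /t a0 nth_nil => x; exact: nearW.
exists U; split.
- by move=> m; exact: tlc.
- move=> x y xy; apply: contrapT => nU.
  have e l : U l x = U l y.
    by apply/eqP; apply: contrapT => /negP Ul; apply: nU; exists l.
  have FE i k : (k < (J i).+2)%N -> F i k x = F i k y.
    by move=> /tF Fdet; exact: Udet Fdet e.
  have TE i : T i x = T i y.
    by apply: negb_inj; exact: (FE i 1%N).
  have Tsep i : itinerary (J i) x <> itinerary (J i) y -> T i x.
    move=> nJ; apply: contrapT => /negP nT; apply: nJ; apply/itineraryP => j jJ.
    by have := FE i j.+2 jJ; rewrite /= -TE (negbTE nT) !andbT.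
  have [i0 xyi0] : exists i0, itinerary i0 x <> itinerary i0 y.
    apply: contrapT => ne; move/eqP: xy; apply; apply: itinerary_inj => i.
    by apply: contrapT => nei; apply: ne; exists i.
  have xyJ i : (i0 <= i)%N -> itinerary (J i) x <> itinerary (J i) y.
    move=> i0i; apply: contra_not xyi0; apply: itinerary_leq.
    exact: leq_trans (J_ge i).
  have TP z : (forall i, (i0 <= i)%N -> T i z) -> periodic_upto f (n i0) z.
    move=> Tz; have [p Pp pz] := asboolP _ (Tz i0 (leqnn _)).
    suff pzk k : itinerary (J (i0 + k)%N) p = itinerary (J (i0 + k)%N) z.
      rewrite (_ : z = p)//; apply: itinerary_inj => k.
      apply/esym; apply: (itinerary_leq _ (pzk k)).
      by rewrite (leq_trans _ (J_ge _))// leq_addl.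
    have PSl l : periodic_upto f (n (i0 + l)%N) p.
      by elim: l => [|l IH]; [rewrite addn0 | rewrite addnS; exact: PS].
    elim: k => [|k IH]; first by rewrite addn0.
    have [q Pq qz] := asboolP _ (Tz (i0 + k.+1)%N (leq_addr _ _)).
    suff -> : p = q by [].
    apply: (JP (i0 + k)%N); rewrite -?addnS//.
    rewrite IH; apply/esym; apply: itinerary_leq qz.
    by rewrite addnS.
  have Px : periodic_upto f (n i0) x.
    by apply: TP => i /xyJ; exact: Tsep.
  have Py : periodic_upto f (n i0) y.
    by apply: TP => i /xyJ; rewrite -TE; exact: Tsep.
  (* Descent to stage 0, where no period is allowed. Distinct points of period at most [n i.+1] are
     separated by [J i], so both lie in [T i]; each then equals its witness of period at most
     [n i]. *)
  have : periodic_upto f (n 0) x /\ periodic_upto f (n 0) y.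
    elim: i0 Px Py {xyi0 xyJ TP} => [//|i IH] Px Py.
    have Tx : T i x.
      by apply: Tsep => /(JP _ _ _ Px Py)/eqP; exact/negP.
    have Ty : T i y by rewrite -TE.
    have TPi z : periodic_upto f (n i.+1) z -> T i z -> periodic_upto f (n i) z.
      by move=> Pz /asboolP[p Pp /(JP _ _ _ (PS _ _ Pp) Pz) <-].
    by apply: IH; exact: TPi.
  by rewrite n0 => -[[[|j]]].
- move=> x; have [N HN] := Dfin x; exists (size (t N)) => m y Nm e.
  (* The least [k] with [m < size (t k)] shows that [m] was adjoined at stage [k - 1], which is at
     least [N], so [x] is no exception there. *)
  have [k mk kmin] :=
    ex_minnP (ex_intro (fun k => m < size (t k))%N m.+1 (size_ge _)).
  have Nk : (N < k)%N.
    rewrite ltnNge; apply/negP => kN; have [r tr] := tprefix _ _ kN.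
    by move: Nm; rewrite tr size_cat leqNgt (leq_trans mk)// leq_addr.
  case: k => [//|k] in mk kmin Nk *.
  have km : (size (t k) <= m)%N.
    by rewrite leqNgt; apply/negP => /kmin; rewrite ltnn.
  rewrite -(UE k.+1)//; apply: (tame_extension_nth (tS k)); rewrite ?km ?HN//.
  by move=> l lm; rewrite !UE ?e// (ltn_trans lm).
Qed.

End dynamics.

(** * Extension of flat maps from a closed set to the line *)

Definition smoothstep (R : realType) (t : R) : R := t ^+ 2 * (3 - 2 * t).

(** [a x] and [b x] are meant as the nearest points of a closed set on either side of [x]. On the
    set the quotient is 0 and the value is [h x]; across a gap the cubic step joins the end values
    with zero slope at both ends. *)
Definition gap_interpolation (R : realType) (h a b : R -> R) (x : R) : R :=
  h (a x) + (h (b x) - h (a x)) * smoothstep ((x - a x) / (b x - a x)).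

Section extension.
Context {R : realType}.
Implicit Types (Z : set R) (h : R -> R).

(* The restriction of [h] to [Z] has vanishing derivative. *)
Definition flat_on Z h := forall z, Z z -> forall e, 0 < e ->
  exists2 d, 0 < d & forall y, Z y -> `|y - z| < d ->
    `|h y - h z| <= e * `|y - z|.

Lemma smoothstep_itv (t : R) : 0 <= t <= 1 -> 0 <= smoothstep t <= 1.
Proof.
move=> /andP[t0 t1]; rewrite /smoothstep; apply/andP; split.
  by rewrite mulr_ge0 ?sqr_ge0//; lra.
have : 0 <= (1 - t) ^+ 2 * (1 + 2 * t) by rewrite mulr_ge0 ?sqr_ge0//; lra.
lra.
Qed.


Lemma smoothstep_le2 (t : R) : 0 <= t -> smoothstep t <= 2 * t.
Proof.
move=> t0; rewrite /smoothstep.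
(* This is [2 * t - smoothstep t] after completing the square. *)
have : 0 <= t * (2 * (t - 3 / 4) ^+ 2 + 7 / 8).
  by rewrite mulr_ge0// addr_ge0// mulr_ge0// sqr_ge0.
lra.
Qed.

Lemma smoothstep_le_sqr (t : R) : 0 <= t -> smoothstep t <= 3 * t ^+ 2.
Proof.
move=> t0; rewrite /smoothstep.
have : 0 <= t * (t ^+ 2) by rewrite mulr_ge0// sqr_ge0.
lra.
Qed.

Lemma smoothstepN (t : R) : smoothstep (1 - t) = 1 - smoothstep t.
Proof. by rewrite /smoothstep; ring. Qed.

Lemma smoothstep0 : smoothstep (0 : R) = 0.
Proof. by rewrite /smoothstep expr0n mul0r. Qed.

Lemma derivable_smoothstep_comp (a c u v x : R) :
  derivable (fun y => u + v * smoothstep ((y - a) / c)) x 1.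
Proof. by rewrite /smoothstep; apply: ex_derive. Qed.

(** With [s] the value of the step, the result is a convex combination of [ha] and [hb], so the
    error is at most [e * ((a - z) + s * (b - a))]; and [s * (b - a)] is at most [2 * (x - a)]. *)
Lemma gap_interpolation_bound (e z a x b hz ha hb : R) : 0 <= e ->
  z <= a -> a <= x -> x <= b ->
  `|ha - hz| <= e * (a - z) -> `|hb - hz| <= e * (b - z) ->
  `|ha + (hb - ha) * smoothstep ((x - a) / (b - a)) - hz| <= 2 * e * (x - z).
Proof.
move=> e0 za ax xb haz hbz.
have [t0 tE] : 0 <= (x - a) / (b - a) <= 1 /\ (x - a) / (b - a) * (b - a) = x - a.
  have [ab|ba] := ltP a b; last first.
    have -> : x = a by lra.
    by rewrite subrr mul0r lexx ler01 mul0r.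
  have ab0 : 0 < b - a by rewrite subr_gt0.
  rewrite divr_ge0 ?ler_pdivrMr ?mul1r ?mulfVK ?gt_eqF//; last 2 [lra|lra].
  by rewrite ltW.
move: t0 tE; set t := (_ / _) => t0 tE.
have /andP[s0 s1] := smoothstep_itv t0.
have s2 : smoothstep t <= 2 * t by apply: smoothstep_le2; case/andP: t0.
move: (smoothstep t) s0 s1 s2 => s s0 s1 s2.
have -> : ha + (hb - ha) * s - hz = (1 - s) * (ha - hz) + s * (hb - hz) by ring.
rewrite (le_trans (ler_normD _ _))// !normrM (ger0_norm s0) ger0_norm ?subr_ge0//.
have H1 : (1 - s) * `|ha - hz| <= (1 - s) * (e * (a - z)).
  by rewrite ler_wpM2l// subr_ge0.
have H2 : s * `|hb - hz| <= s * (e * (b - z)) by rewrite ler_wpM2l.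
rewrite (le_trans (lerD H1 H2))//.
have H3 : e * ((b - a) * s) <= e * ((b - a) * (2 * t)).
  by rewrite ler_wpM2l// ler_wpM2l//; lra.
have H4 : e * ((b - a) * (2 * t)) = e * (2 * (x - a)) by rewrite -tE; ring.
have H5 : 0 <= e * (a - z) by rewrite mulr_ge0// subr_ge0.
rewrite H4 in H3; lra.
Qed.

Section gaps.
Variables (Z : set R) (h a b : R -> R).
Hypothesis Za : forall x, Z (a x).
Hypothesis Zb : forall x, Z (b x).
Hypothesis ax : forall x, a x <= x.
Hypothesis xb : forall x, x <= b x.
Hypothesis a_max : forall x z, Z z -> z <= x -> z <= a x.
Hypothesis b_min : forall x z, Z z -> x <= z -> b x <= z.
Local Notation g := (gap_interpolation h a b).

Lemma gap_left_end z : Z z -> a z = z.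
Proof. by move=> Zz; apply/le_anti; rewrite ax a_max. Qed.

Lemma gap_interpolationE z : Z z -> g z = h z.
Proof.
move=> Zz; rewrite /gap_interpolation gap_left_end//.
by rewrite subrr mul0r smoothstep0 mulr0 addr0.
Qed.

(** Near a point off [Z] both ends are constant, so the function is a cubic polynomial there. *)
Lemma gap_interpolation_derivable x : ~ Z x -> derivable g x 1.
Proof.
move=> nZx.
have neq y : Z y -> y != x by move=> Zy; apply/eqP => e; apply: nZx; rewrite -e.
have ltax : a x < x by rewrite lt_neqAle ax neq.
have ltxb : x < b x by rewrite lt_neqAle xb eq_sym neq.
refine (@near_eq_derivable R R R _ _ x 1 _ (@derivable_smoothstep_comp (a x)
  (b x - a x) (h (a x)) (h (b x) - h (a x)) x)).
have : \forall y \near x, y \in `]a x, b x[.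
  by apply: near_in_itvoo; rewrite in_itv /= ltax.
apply: filterS => y; rewrite in_itv /= => /andP[ay yb].
rewrite /gap_interpolation.
have -> : a y = a x.
  apply/le_anti; rewrite (a_max (Za x) (ltW ay)) andbT.
  rewrite leNgt; apply/negP => axy.
  have : b x <= a y.
    apply: b_min => //; rewrite leNgt; apply/negP => yx.
    by move: axy; rewrite ltNge a_max// ltW.
  by rewrite leNgt (le_lt_trans (ax y)).
have -> // : b y = b x.
apply/le_anti; rewrite (b_min (Zb x) (ltW yb)) /=.
rewrite leNgt; apply/negP => byx.
have : b y <= a x.
  apply: a_max => //; rewrite leNgt; apply/negP => xy.
  by move: byx; rewrite ltNge b_min// ltW.
by rewrite leNgt (lt_le_trans ay).
Qed.

(** If some [w] of [Z] lies in []z, z + d[], the gaps between [z] and [w] have their ends where [h]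
    is flat. Otherwise a gap starts at [z], and the step is quadratic at its left end. *)
Lemma gap_interpolation_flat_right z e : flat_on Z h -> Z z -> 0 < e ->
  exists2 d, 0 < d & forall x, z <= x -> x < z + d ->
    `|g x - h z| <= e * (x - z).
Proof.
move=> hflat Zz e0; have e20 : 0 < e / 2 by rewrite divr_gt0.
have [d d0 hd] := hflat z Zz _ e20.
have [[w [Zw zw wd]]|nw] := pselect (exists w, [/\ Z w, z < w & w < z + d]).
  exists (w - z); first by rewrite subr_gt0.
  move=> x zx xw; have za : z <= a x by exact: a_max.
  have bw : b x <= w by apply: b_min => //; lra.
  have := ax x; have := xb x => xbx axx.
  have -> : e = 2 * (e / 2) by lra.
  apply: gap_interpolation_bound => //; first exact: ltW.
    rewrite -[a x - z]ger0_norm ?subr_ge0//; apply: hd => //.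
    by rewrite ger0_norm ?subr_ge0//; lra.
  rewrite -[b x - z]ger0_norm; last by lra.
  by apply: hd => //; rewrite ger0_norm; lra.
pose w := b (z + d / 2).
have zw : z + d <= w.
  rewrite leNgt; apply/negP => wzd; apply: nw; exists w; split=> //; first exact: Zb.
  by apply: lt_le_trans (xb _); lra.
pose M := `|h w - h z|.
have M0 : 0 <= M by exact: normr_ge0.
(* Chosen so that [3 * M * ((x - z) / d) ^+ 2] is at most [e * (x - z)]; the added 1 covers
   [M = 0]. *)
pose d' := Num.min d (e * d ^+ 2 / (3 * M + 1)).
have M1 : 0 < 3 * M + 1 by lra.
have d'0 : 0 < d' by rewrite lt_min d0 divr_gt0// mulr_gt0// exprn_gt0.
exists d' => // x zx xd'.
have xd : x < z + d by apply: lt_le_trans xd' _; rewrite lerD2l ge_min lexx.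
have axE : a x = z.
  have : z <= a x by exact: a_max.
  rewrite le_eqVlt => /predU1P[//|zax].
  by case: nw; exists (a x); split=> //; have := ax x; lra.
have [->|xz] := eqVneq x z.
  by rewrite gap_interpolationE// !subrr normr0 mulr0.
have {xz}zx' : z < x by rewrite lt_neqAle eq_sym xz.
have bxE : b x = w.
  have H y : z < y -> y < z + d -> z + d <= b y.
    move=> zy yd; rewrite leNgt; apply/negP => byd; apply: nw.
    by exists (b y); split=> //; apply: lt_le_trans (xb y).
  apply/le_anti/andP; split.
    by apply: b_min; [exact: Zb | lra].
  by apply: b_min => //; have := H x zx' xd; lra.
rewrite /gap_interpolation axE bxE addrAC subrr add0r normrM -/M.
set t := (x - z) / (w - z).
have wz0 : 0 < w - z by lra.
have t0 : 0 <= t by rewrite divr_ge0//; lra.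
have t1 : t <= 1 by rewrite ler_pdivrMr// mul1r; lra.
have /andP[s0 _] : 0 <= smoothstep t <= 1 by apply: smoothstep_itv; rewrite t0.
rewrite (ger0_norm s0).
have td : t <= (x - z) / d.
  rewrite /t ler_wpM2l ?subr_ge0// lef_pV2 ?posrE//; lra.
have s3 : smoothstep t <= 3 * ((x - z) / d) ^+ 2.
  rewrite (le_trans (smoothstep_le_sqr t0))// ler_wpM2l// ler_sqr ?nnegrE//.
  by rewrite divr_ge0//; lra.
rewrite (le_trans (ler_wpM2l M0 s3))//.
have -> : M * (3 * ((x - z) / d) ^+ 2) = (3 * M * (x - z) / d ^+ 2) * (x - z).
  by rewrite expr_div_n; ring.
rewrite ler_wpM2r//; first lra.
rewrite ler_pdivrMr ?exprn_gt0//.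
have : x - z < e * d ^+ 2 / (3 * M + 1).
  have : d' <= e * d ^+ 2 / (3 * M + 1) by rewrite ge_min lexx orbT.
  lra.
rewrite ltr_pdivlMr// => H; apply: le_trans (ltW H).
by rewrite mulrC ler_wpM2l; lra.
Qed.

End gaps.

(** The step is symmetric about [1 / 2], so reflection exchanges the ends of a gap. Left-hand
    estimates thus follow from right-hand ones. *)
Lemma gap_interpolation_opp (h a b : R -> R) x : a (- x) <= b (- x) ->
  gap_interpolation h a b (- x) =
  gap_interpolation (h \o -%R) (fun y => - b (- y)) (fun y => - a (- y)) x.
Proof.
rewrite /gap_interpolation /= !opprK le_eqVlt => /predU1P[->|ab].
  by rewrite !subrr !mul0r.
have ba : b (- x) - a (- x) != 0 by rewrite gt_eqF// subr_gt0.
have -> : (x + b (- x)) / (- a (- x) + b (- x)) =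
    1 - (- x - a (- x)) / (b (- x) - a (- x)).
  rewrite [- a _ + _]addrC; field; exact: ba.
by rewrite smoothstepN; ring.
Qed.

Lemma is_derive0_of_flat (g : R -> R) z :
  (forall e, 0 < e -> exists2 d, 0 < d & forall x, `|x - z| < d ->
    `|g x - g z| <= e * `|x - z|) ->
  is_derive z 1 g 0.
Proof.
move=> gflat.
have H : h^-1 *: ((g \o shift z) (h *: 1) - g z) @[h --> 0^'] --> (0 : R).
  apply/cvgrPdist_le => e e0; have [d d0 gd] := gflat e e0.
  near=> h.
  have h0 : h != 0 by near: h; exact: nbhs_dnbhs_neq.
  have hd : `|h| < d by near: h; apply: dnbhs0_lt.
  have hz : h + z - z = h by rewrite addrK.
  rewrite sub0r normrN /= [_ *: 1]mulr1 normrZ normfV.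
  rewrite ler_pdivrMl ?normr_gt0// mulrC.
  by have := gd (h + z); rewrite hz; exact.
by apply: DeriveDef; [apply/cvg_ex; exists 0 | exact: cvg_lim].
Unshelve. all: end_near. Qed.

Lemma closed_has_left_neighbor Z x : closed Z ->
  (exists2 a, Z a & a <= x) ->
  exists a, [/\ Z a, a <= x & forall z, Z z -> z <= x -> z <= a].
Proof.
move=> cZ [a0 Za0 a0x]; pose A := Z `&` [set z | z <= x].
have A0 : A !=set0 by exists a0.
have ubA : ubound A x by move=> z [].
have [Zs sx] : A (sup A).
  have : closed A by apply: closedI => //; exact: closed_le.
  move=> /closure_id AE; have : closure A (sup A).
    by apply: closure_sup => //; exists x.
  by rewrite -AE.
exists (sup A); split=> // z Zz zx; apply: ub_le_sup; [by exists x | by []].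
Qed.

Lemma flat_extension Z h : closed Z -> (forall x, exists2 a, Z a & a <= x) ->
  (forall x, exists2 b, Z b & x <= b) -> flat_on Z h ->
  exists g : R -> R, [/\ forall z, Z z -> g z = h z,
    forall x, derivable g x 1 & forall z, Z z -> derive1 g z = 0].
Proof.
move=> cZ Zl Zr hflat.
have [a aP] := choice (fun x => closed_has_left_neighbor cZ (Zl x)).
pose Z' := [set z | Z (- z)].
have cZ' : closed Z'.
  by apply: (@preimage_closed _ _ -%R) => // x _; exact: opp_continuous.
have Z'l x : exists2 w, Z' w & w <= x.
  have [w Zw xw] := Zr (- x); exists (- w); first by rewrite /Z' /= opprK.
  by rewrite lerNl.
have [b' b'P] := choice (fun x => closed_has_left_neighbor cZ' (Z'l x)).
pose b x := - b' (- x).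
have Za x : Z (a x) by have [] := aP x.
have Zb x : Z (b x) by have [] := b'P (- x).
have ax x : a x <= x by have [] := aP x.
have xb x : x <= b x by have [_ + _] := b'P (- x); rewrite lerNr.
have amax x z : Z z -> z <= x -> z <= a x by have [_ _] := aP x; exact.
have bmin x z : Z z -> x <= z -> b x <= z.
  move=> Zz xz; have [_ _ H] := b'P (- x).
  by rewrite /b lerNl; apply: H; rewrite /Z' /= ?opprK// lerNl opprK.
pose g := gap_interpolation h a b.
have gE z : Z z -> g z = h z by move=> Zz; exact: gap_interpolationE ax amax _ Zz.
have Z'flat : flat_on Z' (h \o -%R).
  move=> z Zz e e0; have [d d0 hd] := hflat _ Zz e e0.
  exists d => // y Zy yz; rewrite /= -normrN opprB -[y - z]opprB normrN.
  rewrite -[`|z - y|]normrN opprB in yz *.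
  have -> : `|h (- z) - h (- y)| = `|h (- y) - h (- z)| by rewrite distrC.
  have -> : `|y - z| = `|- y - - z| by rewrite -normrN; congr (`| _ |); ring.
  by apply: hd => //; rewrite -normrN; move: yz; congr (`| _ | < _); ring.
have gflat z e : Z z -> 0 < e -> exists2 d, 0 < d & forall x, `|x - z| < d ->
    `|g x - g z| <= e * `|x - z|.
  move=> Zz e0.
  have [d1 d10 H1] := gap_interpolation_flat_right Za Zb ax xb amax bmin hflat Zz e0.
  have Z'z : Z' (- z) by rewrite /Z' /= opprK.
  have [||||||d2 d20 H2] := @gap_interpolation_flat_right Z' (h \o -%R)
    (fun y => - b (- y)) (fun y => - a (- y)) _ _ _ _ _ _ (- z) e Z'flat Z'z e0.
  - by move=> x; rewrite /Z' /= opprK.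
  - by move=> x; rewrite /Z' /= opprK.
  - by move=> x; rewrite lerNl.
  - by move=> x; rewrite lerNr.
  - by move=> x y Zy yx; rewrite lerNr; apply: bmin => //; rewrite lerN2.
  - by move=> x y Zy yx; rewrite lerNl; apply: amax => //; rewrite lerN2.
  exists (Num.min d1 d2); first by rewrite lt_min d10.
  move=> x; rewrite lt_min (gE z Zz) => /andP[xd1 xd2].
  have [zx|xz] := leP z x.
    rewrite ger0_norm ?subr_ge0// in xd1 *.
    by apply: H1 => //; lra.
  rewrite distrC gtr0_norm ?subr_gt0// in xd2 *.
  have := H2 (- x); rewrite -gap_interpolation_opp ?opprK; last first.
    exact: le_trans (xb _).
  rewrite /= opprK (_ : - x + z = z - x); last by rewrite addrC.
  by rewrite -/g; apply; lra.
have gz z : Z z -> is_derive z 1 g 0.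
  by move=> Zz; apply: is_derive0_of_flat => e; exact: gflat.
exists g; split=> //.
- move=> x; have [Zx|nZx] := pselect (Z x).
    exact: @ex_derive _ _ _ _ _ _ _ (gz x Zx).
  exact: gap_interpolation_derivable Za Zb ax xb amax bmin _ nZx.
- by move=> z /gz zd; rewrite derive1E; exact: derive_val.
Qed.

End extension.

(** * The embedding by weighted sums *)

Section embedding.
Context {R : realType} {X : topologicalType}.
Variable U : nat -> X -> bool.
Hypothesis X_compact : compact [set: X].
Hypothesis U_lc : forall m, locally_constant (U m).
Hypothesis U_sep : forall x y, x != y -> exists m, U m x != U m y.

(** The powers of 4 make each weight exceed the sum of all later ones; the factorial makes the ratio
    of consecutive weights tend to 0. *)
Let wt (m : nat) : R := (4 ^+ m * m`!%:R)^-1.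

Let wt_gt0 m : 0 < wt m.
Proof. by rewrite invr_gt0 mulr_gt0 ?exprn_gt0// ltr0n fact_gt0. Qed.

Let wtS m : wt m.+1 = wt m / (4 * m.+1%:R).
Proof. by rewrite /wt -invfM exprS factS natrM; congr (_^-1); ring. Qed.

Let wtS_le m : wt m.+1 <= wt m / 4.
Proof.
rewrite wtS ler_wpM2l ?(ltW (wt_gt0 m))// lef_pV2 ?posrE ?mulr_gt0// ?ltr0n//.
by rewrite ler_peMr// ler1n.
Qed.

Let wt_le m : wt m <= m.+1%:R^-1.
Proof.
rewrite lef_pV2 ?posrE ?mulr_gt0 ?exprn_gt0 ?ltr0n ?fact_gt0//.
rewrite -natrX -natrM ler_nat (leq_trans (ltn_expl m (isT : 1 < 4)%N))//.
by rewrite leq_pmulr// fact_gt0.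
Qed.

Let wt_mono m n : (m <= n)%N -> wt n <= wt m.
Proof.
move=> /subnKC <-; elim: (n - m)%N => [|k IH]; first by rewrite addn0.
rewrite addnS (le_trans (wtS_le _))// (le_trans _ IH)//.
by rewrite ler_pdivrMr// ler_peMr ?ltW//; lra.
Qed.

Let psum n x : R := \sum_(m < n) wt m * (U m x)%:R.

(** The partial sums are nondecreasing and bounded, so the supremum is the sum of the series. *)
Definition digit_sum x : R := sup (range (psum ^~ x)).
Local Notation psi := digit_sum.

Let psumS n x : psum n.+1 x = psum n x + wt n * (U n x)%:R.
Proof. by rewrite /psum big_ord_recr. Qed.

(** As [wt m.+1 <= wt m / 4], the term [wt m] is at most [4 / 3 * (wt m - wt m.+1)], which
    telescopes. *)
Let psum_le n k x : (n <= k)%N ->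
  psum n x <= psum k x <= psum n x + 4 / 3 * (wt n - wt k).
Proof.
move=> /subnKC <-; elim: (k - n)%N => [|j IH].
  by rewrite addn0 lexx subrr mulr0 addr0 lexx.
rewrite addnS psumS; move: IH; set m := (n + j)%N => /andP[IH1 IH2].
have := wtS_le m; have := wt_gt0 m; case: (U m x) => /= h1 h2; apply/andP; lra.
Qed.

Let psi_bounds n x : psum n x <= psi x <= psum n x + 4 / 3 * wt n.
Proof.
have ub : ubound (range (psum ^~ x)) (psum n x + 4 / 3 * wt n).
  move=> _ [k _ <-]; have [kn|nk] := leqP k n.
    have /andP[h _] := psum_le x kn; have := wt_gt0 n; lra.
  have /andP[_ h] := psum_le x (ltnW nk); have := wt_gt0 k; lra.
apply/andP; split.
  by apply: ub_le_sup; [exists (psum n x + 4 / 3 * wt n) | exists n].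
by apply: ge_sup => //; exists (psum 0 x), 0%N.
Qed.

Let agree_psum n x y : (forall l, (l < n)%N -> U l x = U l y) ->
  psum n x = psum n y.
Proof. by move=> e; apply: eq_bigr => -[l ln] _ /=; rewrite e. Qed.

Lemma digit_sum_agree n x y : (forall l, (l < n)%N -> U l x = U l y) ->
  `|psi x - psi y| <= 4 / 3 * wt n.
Proof.
move=> /agree_psum e; have /andP[a b] := psi_bounds n x.
have /andP[c d] := psi_bounds n y; rewrite e in a b.
by rewrite ler_norml; apply/andP; split; lra.
Qed.

(** The digit at [n] contributes [wt n]; the later ones offset at most [4 / 3 * wt n.+1], which is
    at most a third of it. *)
Lemma digit_sum_differ n x y : (forall l, (l < n)%N -> U l x = U l y) ->
  U n x != U n y -> 2 / 3 * wt n <= `|psi x - psi y|.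
Proof.
wlog Ux : x y / U n x = true => [H e Un|].
  case Ux : (U n x); first by apply: H.
  rewrite distrC; apply: H => //; last by rewrite eq_sym.
    by move: Un; rewrite Ux; case: (U n y).
  by move=> l ln; rewrite e.
move=> /agree_psum e; rewrite Ux; case Uy : (U n y) => // _.
have /andP[a _] := psi_bounds n.+1 x; have /andP[_ b] := psi_bounds n.+1 y.
have := wtS_le n; rewrite !psumS Ux Uy e /= in a b * => c.
apply: le_trans (ler_norm _); lra.
Qed.

Lemma first_difference x y : x != y -> exists n,
  (forall l, (l < n)%N -> U l x = U l y) /\ U n x != U n y.
Proof.
move=> /U_sep ex; have [n Un nmin] := ex_minnP ex; exists n; split=> // l.
by rewrite ltnNge => ln; apply/eqP; apply: contraNT ln; exact: nmin.
Qed.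

Lemma digit_sum_close n x y : `|psi x - psi y| < 2 / 3 * wt n ->
  forall l, (l <= n)%N -> U l x = U l y.
Proof.
move=> xy l ln; have [->//|/first_difference[m [em Um]]] := eqVneq x y.
apply: (em); rewrite ltnNge; apply/negP => ml.
have := digit_sum_differ em Um; rewrite leNgt => /negP; apply.
apply: lt_le_trans xy _; rewrite ler_wpM2l//.
by apply: wt_mono; exact: leq_trans ln.
Qed.

Lemma digit_sum_inj : injective psi.
Proof.
move=> x y e; apply/eqP; apply: contraT => /first_difference[n [en Un]].
have := digit_sum_differ en Un; rewrite e subrr normr0 leNgt mulr_gt0//.
Qed.

Lemma digit_sum_itv x : 0 <= psi x <= 4 / 3.
Proof.
have := psi_bounds 0 x; rewrite /psum big_ord0 add0r.
by rewrite /wt expr0 fact0 mulr1 invr1 mulr1.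
Qed.

Let wt_small (e : R) : 0 < e -> exists n, wt n < e.
Proof.
move=> e0; exists (Num.truncn e^-1); rewrite (le_lt_trans (wt_le _))//.
rewrite invf_plt ?posrE//; exact: truncnS_gt.
Qed.

Lemma agree_near n x : \forall y \near x, forall l, (l < n)%N -> U l y = U l x.
Proof.
have := locally_constant_mkseq (n := n) (fun j _ => U_lc j) x.
apply: filterS => y e l ln.
by rewrite -(nth_mkseq false (U ^~ y) ln) e nth_mkseq.
Qed.

Lemma digit_sum_continuous : continuous psi.
Proof.
move=> x; apply/cvgrPdist_le => e e0.
have e2 : 0 < e / 2 by rewrite divr_gt0.
have [n wn] := wt_small e2.
apply: filterS (agree_near n x) => y yx.
rewrite (le_trans (digit_sum_agree (n := n) _))//; last lra.
by move=> l ln; rewrite yx.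
Qed.

(** Every point other than [x] is separated from [x] by some [U m], and compactness bounds [m] off
    [A]. This yields the continuity of the inverse of [psi]. *)
Lemma agree_nbhs x (A : set X) : nbhs x A ->
  exists n, forall y, (forall l, (l < n)%N -> U l y = U l x) -> A y.
Proof.
move=> Ax; apply: (@compact_uniform X
  (fun n y => (forall l, (l < n)%N -> U l y = U l x) -> A y) X_compact).
  by move=> n y H e; apply: H => l ln; apply: e; exact: ltnW.
move=> y; have [->|/U_sep[m Um]] := eqVneq y x.
  by exists 0%N; apply: filterS Ax.
exists m.+1; apply: filterS (U_lc m y) => z e /(_ m (ltnSn m)) e'.
by move: Um; rewrite -e e' eqxx.
Qed.

Lemma digit_sum_open x (A : set X) : nbhs x A ->
  exists2 d : R, 0 < d & forall y, `|psi y - psi x| < d -> A y.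
Proof.
move=> /agree_nbhs[n nA]; exists (2 / 3 * wt n); first by rewrite mulr_gt0.
by move=> y /digit_sum_close e; apply: nA => l ln; apply: e; exact: ltnW.
Qed.

(** If [x] and [y] first differ at a large [n], their images agree up to [n] included: below [M] by
    continuity of [f], from [M] on by tameness. So [wt n.+1] is compared with [wt n]. *)
Lemma digit_sum_flat (f : X -> X) : continuous f ->
  (forall x, exists M, forall m y, (M <= m)%N ->
    (forall l, (l < m)%N -> U l x = U l y) -> U m (f x) = U m (f y)) ->
  forall x (e : R), 0 < e -> exists2 d : R, 0 < d & forall y, `|psi y - psi x| < d ->
    `|psi (f y) - psi (f x)| <= e * `|psi y - psi x|.
Proof.
move=> fc tame x e e0; have [M HM] := tame x.
have [k Hk] := agree_nbhs (fc x _ (agree_near M (f x))).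
pose N := maxn k (maxn M (Num.truncn e^-1)).
exists (2 / 3 * wt N) => [|y yx]; first by rewrite mulr_gt0.
have [->|/first_difference[n [en Un]]] := eqVneq y x.
  by rewrite !subrr normr0 mulr0.
have Nn : (N < n)%N.
  rewrite ltnNge; apply/negP => nN; move/negP: Un; apply; apply/eqP.
  exact: (digit_sum_close yx).
have [kn Mn en'] : [/\ (k <= n)%N, (M <= n)%N & (Num.truncn e^-1 <= n)%N].
  by move: (ltnW Nn); rewrite !geq_max => /and3P[].
have fen l : (l < n.+1)%N -> U l (f y) = U l (f x).
  rewrite ltnS => ln; have [lM|Ml] := ltnP l M.
    by apply: Hk => // j jk; apply: en; exact: leq_trans kn.
  apply/esym; apply: HM => // j jl; apply/esym; apply: en.
  exact: leq_trans ln.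
have h1 := digit_sum_agree fen; have h2 := digit_sum_differ en Un.
apply: (le_trans h1); rewrite wtS.
have h3 : n.+1%:R^-1 <= e.
  rewrite invf_ple ?posrE//; apply: le_trans (ltW (truncnS_gt _)) _.
  by rewrite ler_nat ltnS.
apply: le_trans (ler_wpM2l (ltW e0) h2).
have h4 : wt n * n.+1%:R^-1 <= wt n * e by rewrite ler_wpM2l// ltW.
have h5 : 0 <= wt n * e by rewrite mulr_ge0 ?ltW.
have -> : 4 / 3 * (wt n / (4 * n.+1%:R)) = 1 / 3 * (wt n * n.+1%:R^-1).
  by rewrite invfM; field.
have -> : e * (2 / 3 * wt n) = 2 / 3 * (wt n * e) by ring.
have aux (p q : R) : q <= p -> 0 <= p -> 1 / 3 * q <= 2 / 3 * p by lra.
exact: aux.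
Qed.

End embedding.

(** * Clopen sets of a compact metrizable space *)

Section clopen_enumeration.
Context {R : realType} {X : topologicalType}.
Hypothesis X_zero_dim : has_clopen_basis X.
Hypothesis X_compact : compact [set: X].
Hypothesis X_metrizable : metrizable R X.

Lemma clopen_enumeration : exists V : nat -> X -> bool,
  (forall j, locally_constant (V j)) /\
  (forall W : X -> bool, locally_constant W -> exists j, V j =1 W).
Proof.
have [M [h [k [hc kc hk kh]]]] := X_metrizable.
have [[x0 _]|X0] := pselect (exists x : X, True); last first.
  exists (fun _ _ => false); split=> [j x|W _]; first exact: nearW.
  by exists 0%N => x; case: X0; exists x.
have M_compact : compact [set: M].
  rewrite (_ : [set: M] = h @` [set: X]); last first.
    by apply/seteqP; split=> // y _; exists (k y).
  by apply: continuous_compact => //; exact: continuous_subspaceT.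
pose Mp : pseudoPMetricType R :=
  HB.pack (M : Type) (isPointed.Build M (h x0)) (M : pseudoMetricType R).
have [s] := @clopen_surj R Mp M_compact.
exists (fun j x => `[< s j (h x) >]); split=> [j|W Wlc].
  apply/locally_constant_clopen.
  rewrite (_ : [set x | _] = h @^-1` s j); last first.
    by apply/seteqP; split=> x /= /asboolP.
  have [sj_open sj_closed] : @clopen Mp (s j) by exact: funS.
  by split; [apply: open_comp|apply: preimage_closed] => // x _; exact: hc.
have [Wo Wc] := (locally_constant_clopen W).1 Wlc.
have kW : @clopen Mp (k @^-1` [set x | W x]).
  by split; [apply: open_comp|apply: preimage_closed] => // x _; exact: kc.
have [j _ sj] := @surj _ _ _ _ s (k @^-1` [set x | W x]) kW.
exists j => x; rewrite sj /= hk; exact: asboolb.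
Qed.

Lemma clopen_separation (x y : X) : x != y ->
  exists W : X -> bool, [/\ locally_constant W, W x & ~~ W y].
Proof.
have [M [h [k [hc kc hk kh]]]] := X_metrizable => xy.
have [B [_ Bb] Bc] := X_zero_dim.
have : nbhs x (h @^-1` ~` [set h y]).
  apply: hc; apply: open_nbhs_nbhs; split; last first.
    by move=> /= /(can_inj hk)/eqP; exact/negP.
  rewrite openC; apply: accessible_closed_set1.
  exact/hausdorff_accessible/metric_hausdorff.
move=> /Bb[C [BC Cx] Cy]; exists (fun z => z \in C); split.
- by apply/locally_constant_clopen; rewrite set_mem_set; exact: Bc.
- by rewrite inE.
- by apply/negP; rewrite inE => /Cy; apply.
Qed.

Lemma zero_dim_hausdorff : hausdorff_space X.
Proof.
move=> x y xy; apply/eqP; apply: contraT => /clopen_separation[W [Wlc Wx Wy]].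
have [z [/= -> ]] := xy _ _ (Wlc x) (Wlc y).
by rewrite Wx (negbTE Wy).
Qed.

End clopen_enumeration.

(** * Attraction forced by a vanishing derivative *)

Section attractors.
Context {R : realType} {X : topologicalType} (f : X -> X).

Lemma flat_bound (g : R -> R) z : derivable g z 1 -> derive1 g z = 0 ->
  exists2 d, 0 < d & forall y, `|y - z| < d -> `|g y - g z| <= 1 / 2 * `|y - z|.
Proof.
move=> gz; rewrite derive1E => Dg.
have : h^-1 *: ((g \o shift z) (h *: 1) - g z) @[h --> 0^'] --> 'D_1 g z.
  exact: gz.
rewrite Dg => /cvgrPdist_le/(_ (1 / 2)) [|d /= d0 hd]; first by lra.
exists d => // y yz; have [->|yz0] := eqVneq y z.
  by rewrite !subrr normr0 mulr0.
have h0 : y - z != 0 by rewrite subr_eq0.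
have := hd (y - z); rewrite /= !sub0r !normrN => /(_ yz h0).
rewrite [_ *: 1]mulr1 subrK normrZ normfV ler_pdivrMl ?normr_gt0//.
by rewrite mulrC.
Qed.

Lemma uniform_positive k (P : nat -> R -> Prop) :
  (forall i d e, P i d -> e <= d -> P i e) ->
  (forall i, (i < k)%N -> exists2 d, 0 < d & P i d) ->
  exists2 d, 0 < d & forall i, (i < k)%N -> P i d.
Proof.
move=> Pmono; elim: k => [|k IH] Pk; first by exists 1.
have [|d d0 Pd] := IH; first by move=> i ik; apply: Pk; exact: ltnW.
have [e e0 Pe] := Pk k (ltnSn k).
exists (Num.min d e); first by rewrite lt_min d0.
move=> i; rewrite ltnS leq_eqVlt => /predU1P[->|ik].
  by apply: Pmono Pe _; rewrite ge_min lexx orbT.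
by apply: Pmono (Pd i ik) _; rewrite ge_min lexx.
Qed.

Lemma flat_embedding_attracting (V : nat -> X -> bool) (phi : X -> R)
    (g : R -> R) (p : set X) :
  compact [set: X] ->
  (forall j, locally_constant (V j)) ->
  (forall W : X -> bool, locally_constant W -> exists j, V j =1 W) ->
  has_clopen_basis X ->
  continuous phi -> injective phi ->
  (forall x, phi (f x) = g (phi x)) ->
  (forall x, exists2 d, 0 < d & forall y, `|y - phi x| < d ->
     `|g y - g (phi x)| <= 1 / 2 * `|y - phi x|) ->
  finite_orbit f p -> attracting f p.
Proof.
move=> X_compact V_lc V_surj [B [_ Bb] Bc] phic phi_inj phif gflat.
move=> [x [k [k1 fkx pE]]].
pose q i := iter i f x.
have qf i : (i < k)%N -> exists2 j, (j < k)%N & q j = f (q i).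
  rewrite leq_eqVlt => /predU1P[ik|ik]; last by exists i.+1.
  by exists 0%N; rewrite // /q -iterS ik fkx.
pose near_orbit r y := exists2 i, (i < k)%N & `|phi y - phi (q i)| < r.
have near_open r y : near_orbit r y -> \forall z \near y, near_orbit r z.
  move=> [i ik yi]; have := phic y.
  have yr : 0 < r - `|phi y - phi (q i)| by rewrite subr_gt0.
  move=> /cvgrPdist_lt/(_ _ yr); apply: filterS => z zy; exists i => //.
  rewrite (_ : phi z - phi (q i) =
    (phi y - phi (q i)) - (phi y - phi z)); last by ring.
  by apply: le_lt_trans (ler_normB _ _) _; rewrite -ltrBrDl.
have [d d0 dP] : exists2 d, 0 < d & forall i, (i < k)%N -> forall y,
    `|y - phi (q i)| < d -> `|g y - g (phi (q i))| <= 1 / 2 * `|y - phi (q i)|.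
  apply: (@uniform_positive k (fun i d => forall y, `|y - phi (q i)| < d ->
    `|g y - g (phi (q i))| <= 1 / 2 * `|y - phi (q i)|)) => [i e e' He ee' y ye|i _].
    by apply: He; exact: lt_le_trans ee'.
  exact: gflat.
have contract r y : r <= d -> near_orbit r y -> near_orbit (r / 2) (f y).
  move=> rd [i ik yi]; have [j jk qj] := qf i ik; exists j => //.
  rewrite qj !phif; apply: le_lt_trans (dP i ik _ _) _.
    exact: lt_le_trans rd.
  lra.
(* [K] is closed, so it is covered by a clopen [u] inside the [d]-neighbourhood of the orbit; [f]
   maps that neighbourhood into [K], whence [u] is stable. *)
pose K y := exists2 i, (i < k)%N & `|phi y - phi (q i)| <= d / 2.
have Kc y : ~ K y -> \forall z \near y, ~ K z.
  move=> nK.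
  have [e e0 eP] : exists2 e, 0 < e & forall i, (i < k)%N ->
      d / 2 + e <= `|phi y - phi (q i)|.
    apply: (@uniform_positive k (fun i e => d / 2 + e <= `|phi y - phi (q i)|)).
      by move=> i e e' He ee'; apply: le_trans He; rewrite lerD2l.
    move=> i ik; exists (`|phi y - phi (q i)| - d / 2); last by lra.
    rewrite subr_gt0 ltNge; apply/negP => yi; apply: nK; by exists i.
  have := phic y => /cvgrPdist_lt/(_ _ e0); apply: filterS => z zy [i ik zi].
  have := eP i ik; rewrite leNgt => /negP; apply.
  rewrite (_ : phi y - phi (q i) =
    (phi y - phi z) + (phi z - phi (q i))); last by ring.
  by apply: le_lt_trans (ler_normD _ _) _; lra.
have KB y : near_orbit (d / 2) y -> K y.
  by move=> [i ik yi]; exists i => //; exact: ltW.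
have [|N [ulc uK]] := clopen_subcover X_compact V_lc
    (good := fun j => forall y, V j y -> near_orbit d y) Kc.
  move=> y [i ik yi].
  have yd : near_orbit d y by exists i => //; apply: le_lt_trans yi _; lra.
  have [C [BC Cy] Cd] := Bb y _ (near_open _ _ yd).
  have [|j Vj] := V_surj (fun z => z \in C).
    by apply/locally_constant_clopen; rewrite set_mem_set; exact: Bc.
  by exists j; [move=> z; rewrite Vj inE; exact: Cd | rewrite Vj inE].
set u := (fun y => has _ _) in ulc uK.
have ud y : u y -> near_orbit d y.
  by move=> /hasP[j _ /andP[/asboolP]]; exact.
have orbit_p i : p (q i).
  rewrite pE; exists (i %% k)%N; first by rewrite /= ltn_mod.
  rewrite {2}(divn_eq i k) /q addnC iterD; congr (iter _ f _).
  by elim: (i %/ k)%N => [//|n IH]; rewrite mulSn iterD -IH fkx.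
have pu y : p y -> u y.
  rewrite pE => -[i ik <-]; apply: uK; exists i => //.
  by rewrite subrr normr0 divr_ge0// ltW.
exists [set y | u y]; split.
- move=> _ [y uy <-]; apply/uK/KB; apply: contract => //; exact: ud.
- exact/locally_constant_clopen.
- by [].
apply/seteqP; split=> y.
  (* A point of all the images is within [d / 2 ^+ n] of the orbit for every [n], so it is on the
     orbit by injectivity of [phi]. *)
  move=> yn; have yr n : near_orbit (d / 2 ^+ n) y.
    have [z uz <-] := yn n I; elim: n => [|n IH]; first by rewrite divr1; exact: ud.
    rewrite iterS exprSr invfM mulrA; apply: contract => //.
    by rewrite ler_pdivrMr ?exprn_gt0// ler_peMr ?exprn_ege1 ?ler1n// ltW.
  apply: contrapT => npy.
  have [e e0 eP] : exists2 e, 0 < e & forall i, (i < k)%N ->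
      e <= `|phi y - phi (q i)|.
    apply: (@uniform_positive k (fun i e => e <= `|phi y - phi (q i)|)).
      by move=> i e e' He ee'; exact: le_trans He.
    move=> i ik; exists (`|phi y - phi (q i)|) => //.
    rewrite normr_gt0 subr_eq0; apply/eqP => /phi_inj yq; apply: npy.
    by rewrite yq.
  have [i ik yi] := yr (Num.truncn (d / e)).+1.
  have := eP i ik; rewrite leNgt => /negP; apply; apply: lt_le_trans yi _.
  rewrite ler_pdivrMr ?exprn_gt0// mulrC -ler_pdivrMr//.
  apply: le_trans (ltW (truncnS_gt _)) _.
  by rewrite -natrX ler_nat ltnW// ltn_expl.
move=> py n _; move: py; rewrite pE => -[i ik <-].
(* [q i] recurs after [n * k] steps, so it is the [n]-th image of this point of the orbit. *)
exists (q (n * k - n + i)%N); first exact/pu/orbit_p.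
rewrite /q -iterD addnA subnKC ?leq_pmulr// addnC iterD; congr (iter _ f _).
by elim: n => [//|n IH]; rewrite mulSn iterD IH.
Qed.

End attractors.

(** * From a flat embedding to a map of the line *)

Lemma embeds_of_flat_embedding (R : realType) (X : topologicalType)
    (f : X -> X) (psi : X -> R) (m M : R) :
  compact [set: X] -> continuous psi -> injective psi ->
  (forall x, m <= psi x <= M) ->
  (forall x (A : set X), nbhs x A ->
    exists2 d : R, 0 < d & forall y, `|psi y - psi x| < d -> A y) ->
  (forall x (e : R), 0 < e -> exists2 d : R, 0 < d &
    forall y, `|psi y - psi x| < d ->
      `|psi (f y) - psi (f x)| <= e * `|psi y - psi x|) ->
  embeds_with_vanishing_derivative R f.
Proof.
move=> X_compact psic psi_inj psi_itv psi_open psi_flat.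
pose Z := range psi.
have cZ : closed Z.
  apply: compact_closed; first exact: Rhausdorff.
  by apply: continuous_compact => //; exact: continuous_subspaceT.
pose h y := if pselect (exists x, psi x = y) is left H
  then psi (f (projT1 (cid H))) else 0.
have hE x : h (psi x) = psi (f x).
  rewrite /h; case: pselect => [H|[]]; last by exists x.
  by congr (psi (f _)); apply: psi_inj; exact: projT2 (cid H).
have h0 y : (y < m) || (M < y) -> h y = 0.
  rewrite /h; case: pselect => // -[x xy].
  by have := psi_itv x; rewrite xy => /andP[a b]; rewrite !ltNge a b.
(* Two half-lines, on which [h] is 0, give every real a neighbour in the closed set on each side.
   Being at distance 1 from [[m, M]], they do not interfere with flatness on [Z]. *)
pose Z' := Z `|` ([set y | y <= m - 1] `|` [set y | M + 1 <= y]).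
have cZ' : closed Z'.
  by apply: closedU => //; apply: closedU; [exact: closed_le|exact: closed_ge].
have Z'l x : exists2 w, Z' w & w <= x.
  exists (Num.min x (m - 1)); last by rewrite ge_min lexx.
  by right; left; rewrite /= ge_min lexx orbT.
have Z'r x : exists2 w, Z' w & x <= w.
  exists (Num.max x (M + 1)); last by rewrite le_max lexx.
  by right; right; rewrite /= le_max lexx orbT.
have hflat : flat_on Z' h.
  have const z : h z = 0 -> (forall y, Z' y -> `|y - z| < 1 -> h y = 0) ->
      forall e, 0 < e -> exists2 d, 0 < d & forall y, Z' y -> `|y - z| < d ->
      `|h y - h z| <= e * `|y - z|.
    move=> hz hy e e0; exists 1 => // y Zy yz.
    by rewrite hz hy// subrr normr0 mulr_ge0// ltW.
  move=> z [[x _ <-] e e0|[/= zm|/= zM]].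
  - have [d d0 dP] := psi_flat x e e0; have /andP[xm xM] := psi_itv x.
    exists (Num.min d 1); first by rewrite lt_min d0 ltr01.
    move=> w [[y _ <-]|[/= wm|/= wM]]; rewrite lt_min => /andP[yd y1].
    + by rewrite !hE; exact: dP.
    + by move: y1; rewrite ltr_norml; lra.
    + by move: y1; rewrite ltr_norml; lra.
  - apply: const; first by apply: h0; apply/orP; left; lra.
    move=> y _; rewrite ltr_norml => yz; apply: h0; apply/orP; left; lra.
  - apply: const; first by apply: h0; apply/orP; right; lra.
    move=> y _; rewrite ltr_norml => yz; apply: h0; apply/orP; right; lra.
have [g [gE gd g0]] := flat_extension cZ' Z'l Z'r hflat.
have gpsi x : g (psi x) = psi (f x) by rewrite gE ?hE//; left; exists x.
have Zpsi x : psi x \in Z by rewrite inE; exists x.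
pose psiZ x : set_type Z := exist _ (psi x) (Zpsi x).
have psiZE x : set_val (psiZ x) = psi x by rewrite set_valE.
have preim (z : set_type Z) : exists x, psi x = set_val z.
  by have [x _ e] := set_valP z; exists x.
pose psi' z := projT1 (cid (preim z)).
have psi'E z : psi (psi' z) = set_val z := projT2 (cid (preim z)).
exists g, Z, psiZ, psi'; split=> //.
- by split=> // _ [_ [x _ <-] <-]; rewrite gpsi; exists (f x).
- split.
  + apply: (@continuous_comp_initial (set_type Z) X R set_val).
    rewrite (_ : set_val \o psiZ = psi)//; exact/funext.
  + move=> z A /psi_open[d d0 dA].
    have vc : {for z, continuous (set_val : set_type Z -> R)}.
      exact: initial_continuous.
    have := vc; move=> /cvgrPdist_lt/(_ d d0).
    by apply: filterS => w wz; apply: dA; rewrite !psi'E distrC.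
  + by move=> x; apply: psi_inj; rewrite psi'E psiZE.
  + by move=> z; apply: val_inj; rewrite -!set_valE psiZE psi'E.
- by move=> z; rewrite psiZE -psi'E gpsi.
- by move=> z Zz; apply: g0; left.
Qed.

Unset Implicit Arguments.

Theorem theorem1p3 (R : realType) (X : topologicalType) (f : X -> X)
    (X_zero_dim : has_clopen_basis X)
    (X_compact : compact [set: X])
    (X_metrizable : metrizable R X)
    (f_continuous : continuous f) :
  embeds_with_vanishing_derivative R f <->
  (forall p : set X, finite_orbit f p -> attracting f p).
Proof.
have [V [V_lc V_surj]] := clopen_enumeration X_compact X_metrizable.
split=> [[g [Z [psi [psi' [gd _ [psic _ psiK _] gpsi g0]]]]] p|attr].
  pose phi x := set_val (psi x) : R.
  apply: (@flat_embedding_attracting R X f V phi g p) => //.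
  - move=> x; apply: (@continuous_comp _ _ _ psi set_val); first exact: psic.
    exact: initial_continuous.
  - by move=> x y /val_inj e; rewrite -(psiK x) e psiK.
  - by move=> x; rewrite /phi gpsi psiK.
  - move=> x; apply: flat_bound => //; apply: g0; exact: set_valP.
have V_sep (x y : X) : x != y -> exists j, V j x != V j y.
  move=> /(clopen_separation X_zero_dim X_metrizable)[W [Wlc Wx Wy]].
  by have [j Vj] := V_surj W Wlc; exists j; rewrite !Vj Wx (negbTE Wy).
have X_hausdorff := zero_dim_hausdorff X_zero_dim X_metrizable.
have [U [U_lc U_sep tame]] := eventually_tame_sequence X_compact X_hausdorff
  f_continuous V_lc V_surj V_sep attr.
apply: (@embeds_of_flat_embedding R X f (@digit_sum R X U) 0 (4 / 3)) => //.
- exact: digit_sum_continuous.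
- exact: digit_sum_inj.
- exact: digit_sum_itv.
- exact: digit_sum_open.
- exact: digit_sum_flat.
Qed.
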